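(* Let $N\geq1$ be an integer, $s\in(0,1)$, $p\in[1,\infty)$, and let $u\in L^p(\mathbb{R}^N)$ be such that $$(-\Delta)^su=0\quad\text{in }\mathcal{D}'(\mathbb{R}^N).$$ Then $u\equiv0$ (as an element of $L^p(\mathbb{R}^N)$).
   Context: Let $\mathcal{L}^1_s$ denote the space of measurable functions $u:\mathbb{R}^N\to\mathbb{R}$ with $\int_{\mathbb{R}^N}\frac{|u(x)|}{1+|x|^{N+2s}}\,dx<\infty$; by Hölder's inequality $L^q(\mathbb{R}^N)\subset\mathcal{L}^1_s$ for every $q\in[1,\infty]$. For $\varphi\in C^2(\mathbb{R}^N)\cap\mathcal{L}^1_s$, the fractional Laplacian is defined by $$-(-\Delta)^s\varphi(x)=C_{N,s}\lim_{\varepsilon\to0}\int_{|x-y|>\varepsilon}\frac{\varphi(y)-\varphi(x)}{|y-x|^{N+2s}}\,dy,\qquad x\in\mathbb{R}^N,$$ with $C_{N,s}=s(1-s)\pi^{-N/2}4^s\frac{\Gamma(\frac N2+s)}{\Gamma(2-s)}$. For $u\in\mathcal{L}^1_s$, $(-\Delta)^su=0$ in $\mathcal{D}'(\mathbb{R}^N)$ means $\int_{\mathbb{R}^N}u(x)(-\Delta)^s\varphi(x)\,dx=0$ for every $\varphi\in C^\infty_c(\mathbb{R}^N)$. Functions are real-valued. *)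

(* Defs.v *)
From HB Require Import structures.
From mathcomp Require Import all_boot all_order all_algebra.
From mathcomp Require Import all_classical all_reals all_analysis.

Set Implicit Arguments.
Unset Strict Implicit.
Unset Printing Implicit Defensive.

Import Order.TTheory GRing.Theory Num.Theory.
Import numFieldNormedType.Exports.

Local Open Scope classical_set_scope.
Local Open Scope ring_scope.

(* R^N is 'rV[R]_N. It carries the sigma-algebra generated by the coordinate
   functions, i.e., the product of the Borel sigma-algebras, which is the Borel
   sigma-algebra of R^N. *)
Definition row_display : measure_display. Proof. exact. Qed.

Section measurable_row.
Context {R : realType} (n : nat).

Let coord (i : 'I_n) (v : 'rV[R]_n) : measurableTypeR R := v ord0 i.

Let row_set0 : g_sigma_preimage coord set0.
Proof. exact: sigma_algebra0. Qed.

Let row_setC A : g_sigma_preimage coord A -> g_sigma_preimage coord (~` A).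
Proof. exact: sigma_algebraC. Qed.

Let row_bigcup (F : (set 'rV[R]_n)^nat) :
  (forall i, g_sigma_preimage coord (F i)) ->
  g_sigma_preimage coord (\bigcup_i (F i)).
Proof. exact: sigma_algebra_bigcup. Qed.

HB.instance Definition _ := @isMeasurable.Build row_display 'rV[R]_n
  (g_sigma_preimage coord) row_set0 row_setC row_bigcup.

End measurable_row.

Section measurable_row_theory.
Context {R : realType}.

Lemma measurable_row_coord n (i : 'I_n) :
  measurable_fun [set: 'rV[R]_n]
    (fun v : 'rV[R]_n => v ord0 i : measurableTypeR R).
Proof.
move=> _ Y mY; rewrite setTI; apply: sub_sigma_algebra => /=.
rewrite -bigcup_seq/=; exists i => /=; first by rewrite mem_index_enum.
by exists Y => //; rewrite setTI.
Qed.

Lemma measurable_fun_row d (T : measurableType d) n (f : T -> 'rV[R]_n) :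
  (forall i, measurable_fun [set: T]
    (fun t => f t ord0 i : measurableTypeR R)) ->
  measurable_fun [set: T] f.
Proof.
move=> mf _ Y mY; rewrite setTI.
suff: measurable `<=` [set A : set 'rV[R]_n | measurable (f @^-1` A)].
  by move=> /(_ _ mY).
apply: smallest_sub.
  split => [|A mA|F mF] /=.
  - by rewrite preimage_set0.
  - by rewrite setTD -preimage_setC; exact: measurableC.
  - by rewrite preimage_bigcup; exact: bigcupT_measurable.
rewrite -bigcup_seq/=; apply: bigcup_sub => i _ A [B mB <-] /=.
by rewrite setTI; have := mf i measurableT B mB; rewrite setTI.
Qed.

Definition cons_row n (xv : measurableTypeR R * 'rV[R]_n) : 'rV[R]_n.+1 :=
  row_mx (xv.1 : R)%:M xv.2.

Definition uncons_row n (v : 'rV[R]_n.+1) : measurableTypeR R * 'rV[R]_n :=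
  (v ord0 ord0, @rsubmx R 1 1 n v).

Lemma cons_row0 n (xv : measurableTypeR R * 'rV[R]_n) :
  cons_row xv ord0 ord0 = xv.1.
Proof.
have := row_mxEl (xv.1 : R)%:M xv.2 ord0 (ord0 : 'I_1).
by rewrite (_ : lshift n ord0 = ord0) ?mxE//; exact/val_inj.
Qed.

Lemma cons_rowS n (xv : measurableTypeR R * 'rV[R]_n) i :
  cons_row xv ord0 (rshift 1 i) = xv.2 ord0 i.
Proof. exact: row_mxEr. Qed.

Lemma cons_rowK n : cancel (@cons_row n) (@uncons_row n).
Proof.
move=> [x v]; rewrite /uncons_row cons_row0; congr (_, _).
exact: row_mxKr.
Qed.

Lemma measurable_cons_row n : measurable_fun [set: _] (@cons_row n).
Proof.
apply: measurable_fun_row => i; case: (unliftP ord0 i) => [j ->|->].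
  rewrite (_ : lift ord0 j = rshift 1 j); last exact/val_inj.
  under eq_fun do rewrite cons_rowS.
  exact: (measurableT_comp (@measurable_row_coord n j)  measurable_snd).
by under eq_fun do rewrite cons_row0; exact: measurable_fst.
Qed.

Lemma measurable_uncons_row n : measurable_fun [set: _] (@uncons_row n).
Proof.
apply/measurable_fun_pairP; split; first exact: (measurable_row_coord ord0).
apply: measurable_fun_row => i.
by under eq_fun do rewrite /= mxE; exact: measurable_row_coord.
Qed.

End measurable_row_theory.

Section lebesgue_row_step.
Context {R : realType} (n : nat).
Variable mu : {sigma_finite_measure set 'rV[R]_n -> \bar R}.

Definition lebesgue_row_step : set 'rV[R]_n.+1 -> \bar R :=
  pushforward (@lebesgue_measure R \x mu)%E (@cons_row R n).

Let lebesgue_row_step0 : (lebesgue_row_step set0 = 0)%E.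
Proof. by rewrite /lebesgue_row_step /pushforward preimage_set0 measure0. Qed.

Let lebesgue_row_step_ge0 A : (0 <= lebesgue_row_step A)%E.
Proof. by apply: integral_ge0 => x _; exact: measure_ge0. Qed.

Let lebesgue_row_step_sigma_additive : semi_sigma_additive lebesgue_row_step.
Proof.
move=> F mF tF mUF; rewrite /lebesgue_row_step /pushforward preimage_bigcup.
apply: measure_semi_sigma_additive.
- by move=> k; rewrite -[X in measurable X]setTI; exact: measurable_cons_row.
- apply/trivIsetP => i j _ _ ij; rewrite -preimage_setI.
  by move/trivIsetP : tF => /(_ _ _ _ _ ij) ->//; rewrite preimage_set0.
- rewrite -preimage_bigcup -[X in measurable X]setTI.
  exact: measurable_cons_row.
Qed.

HB.instance Definition _ := isMeasure.Build _ _ _ lebesgue_row_step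
  lebesgue_row_step0 lebesgue_row_step_ge0 lebesgue_row_step_sigma_additive.

Let lebesgue_row_step_sigma_finite : sigma_finite setT lebesgue_row_step.
Proof.
have /sigma_finiteP[F [TF ndF Foo]] := sigma_finiteT (@lebesgue_measure R).
have /sigma_finiteP[G [TG ndG Goo]] := sigma_finiteT mu.
exists (fun k => @uncons_row R n @^-1` (F k `*` G k)).
  rewrite -preimage_bigcup; apply/esym/seteqP; split => // v _ /=.
  have [i _ Fi] : (\bigcup_i F i) (v ord0 ord0 : measurableTypeR R).
    by rewrite -TF.
  have [j _ Gj] : (\bigcup_i G i) (@rsubmx R 1 1 n v) by rewrite -TG.
  exists (maxn i j) => //; split.
  - by move: Fi; exact/subsetPset/ndF/leq_maxl.
  - by move: Gj; exact/subsetPset/ndG/leq_maxr.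
move=> k; have [mF Fk] := Foo k; have [mG Gk] := Goo k; split.
  rewrite -[X in measurable X]setTI.
  by apply: measurable_uncons_row => //; exact: measurableX.
rewrite /lebesgue_row_step /pushforward -comp_preimage.
rewrite (_ : uncons_row (n:=n) \o _ = id); last first.
  by apply/funext => x; exact: cons_rowK.
by rewrite preimage_id product_measure1E// lte_mul_pinfty// ge0_fin_numE.
Qed.

HB.instance Definition _ := Measure_isSigmaFinite.Build _ _ _
  lebesgue_row_step lebesgue_row_step_sigma_finite.

End lebesgue_row_step.

Fixpoint lebesgue_row {R : realType} (n : nat) :
    {sigma_finite_measure set 'rV[R]_n -> \bar R} :=
  match n with
  | 0 => \d_(0 : 'rV[R]_0)
  | n'.+1 => lebesgue_row_step (lebesgue_row n')
  end.

Lemma lebesgue_row_box {R : realType} n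
    (A : 'I_n -> set (measurableTypeR R)) : (forall i, measurable (A i)) ->
  lebesgue_row n [set v : 'rV[R]_n | forall i, A i (v ord0 i)] =
    (\prod_(i < n) @lebesgue_measure R (A i))%E.
Proof.
elim: n A => [|n IHn] A mA.
  by rewrite big_ord0 /= diracE mem_set// => -[].
rewrite big_ord_recl -IHn// -product_measure1E//; last first.
  rewrite (_ : mkset _ = \bigcap_(i in [set: 'I_n])
      (fun v : 'rV[R]_n => v ord0 i : measurableTypeR R)
        @^-1` A (lift ord0 i)).
    by apply: fin_bigcap_measurable => // i _;
      rewrite -[X in measurable X]setTI; exact: measurable_row_coord.
  by apply/seteqP; split => v Av i; [move=> _; exact: Av | exact: Av].
rewrite /= /lebesgue_row_step /pushforward; congr product_measure1.
have liftE i : lift ord0 i = rshift 1 i :> 'I_n.+1 by exact/val_inj.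
apply/seteqP; split => [[x v] Av|[x v] [Ax Av] i] /=.
  split => [|i]; first by have := Av ord0; rewrite cons_row0.
  by have := Av (lift ord0 i); rewrite liftE cons_rowS.
case: (unliftP ord0 i) => [j|] ->; last by rewrite cons_row0.
by have := Av j; rewrite liftE cons_rowS.
Qed.

(* The library norm on 'rV[R]_N is the sup norm. *)
Definition enorm {R : realType} {N : nat} (x : 'rV[R]_N) : R :=
  Num.sqrt (\sum_(i < N) x ord0 i ^+ 2).

Definition Gamma {R : realType} (x : R) : R :=
  \int[@lebesgue_measure R]_(t in `]0, +oo[) (t `^ (x - 1) * expR (- t)).

Definition fraclap_const {R : realType} (N : nat) (s : R) : R :=
  s * (1 - s) * pi `^ (- (N%:R / 2)) * 4 `^ s *
    (Gamma (N%:R / 2 + s) / Gamma (2 - s)).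

Definition fraclap {R : realType} {N : nat} (s : R) (phi : 'rV[R]_N -> R)
    (x : 'rV[R]_N) : R :=
  - (fraclap_const N s *
     lim ((\int[@lebesgue_row R N]_(y in [set y | eps < enorm (x - y)])
             ((phi y - phi x) / enorm (y - x) `^ (N%:R + 2 * s)))
            @[eps --> 0^'+])).

Fixpoint Ck {R : realType} {N : nat} (k : nat) (f : 'rV[R]_N -> R) : Prop :=
  continuous f /\
  match k with
  | 0 => True
  | k'.+1 => forall i : 'I_N,
      (forall x, derivable f x (delta_mx ord0 i)) /\
      Ck k' (fun x => 'D_(delta_mx ord0 i) f x)
  end.

Definition test_function {R : realType} {N : nat} (phi : 'rV[R]_N -> R) : Prop :=
  (forall k, Ck k phi) /\ compact (closure [set x | phi x != 0]).

(* The integral is extended-real valued and oo - oo = -oo, so that the equation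
   includes the integrability of u * fraclap s phi (for measurable u); the
   latter is automatic when u is in L^1 with weight 1 / (1 + |x| ^ (N + 2 s)),
   in particular when u is in some L^q, 1 <= q <= oo. *)
Definition fraclap_distr_eq0 {R : realType} {N : nat} (s : R)
    (u : 'rV[R]_N -> R) : Prop :=
  forall phi : 'rV[R]_N -> R, test_function phi ->
    (\int[@lebesgue_row R N]_x (u x * fraclap s phi x)%:E = 0)%E.

(* Main.v *)
(* Let phi be a smooth bump supported in a box and v x the integral of u
   against the translate of phi by x. Substituting h and - h in the principal
   value and averaging turns the fractional Laplacian of phi into the
   absolutely convergent integral of the symmetric second difference quotient
   (phi (x + h) + phi (x - h) - 2 phi x) / (2 |h| ^ (N + 2 s)). By Fubini the
   equation for u then says that the second difference quotients of v
   integrate to 0 at every point.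
   Since |t| <= delta + delta ^ (1 - p) |t| ^ p for every delta > 0, v is
   continuous and tends to 0 at infinity. If v were positive somewhere, it
   would attain its maximum, where the quotients are nonpositive and, for
   large h, negative, although their integral is 0. Hence v <= 0, likewise
   - v <= 0, and u is orthogonal to all bumps. These approximate the
   indicators of the boxes, so u = 0 almost everywhere. *)

From HB Require Import structures.
Require Import Defs.
From mathcomp Require Import all_boot all_order all_algebra.
From mathcomp Require Import all_classical all_reals all_analysis.
From mathcomp Require Import measurable_realfun ring lra.

Set Implicit Arguments.
Unset Strict Implicit.
Unset Printing Implicit Defensive.

Import Order.TTheory GRing.Theory Num.Theory.
Import numFieldNormedType.Exports.

Local Open Scope classical_set_scope.
Local Open Scope ring_scope.

(** * Boxes and invariance of the Lebesgue measure *)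

(** The main obstacle is that [u] lies only in L^p and need not be integrable. Splitting |u| at
    height 1 bounds its integral over a set A by the measure of A plus a constant L, so the bound is
    the same for all translates of a box. For fixed h, the second difference of a bump lives on
    three such translates. Integrating in the base point first therefore leaves a multiple of min(1,
    |h|^2) / |h|^(N+2s), and Fubini applies. This kernel is shown integrable from the volume of
    balls alone, by a dyadic decomposition: s > 0 controls infinity and s < 1 the origin. The same
    argument on the line makes the Gamma integrals converge. That matters because a divergent
    real-valued integral would be 0 by default, and with a zero normalising constant the equation
    would say nothing. The regularity of bumps is expressed by bounds on first and second
    differences. These pass to products of one-variable functions without a Taylor formula in
    several variables. *)

Section oc_boxes.
Context {R : realType} (N : nat).

(** Half-open sides match the intervals that generate the Borel sets of the line, and the class is
    closed under intersection. *)
Definition ocbox (a b : 'rV[R]_N) : set 'rV[R]_N :=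
  [set v | forall i, `]a ord0 i, b ord0 i]%classic (v ord0 i)].

Definition ocboxes : set (set 'rV[R]_N) := [set ocbox a b | a in setT & b in setT].

Lemma measurable_coord_box (A : 'I_N -> set (measurableTypeR R)) :
  (forall i, measurable (A i)) ->
  measurable [set v : 'rV[R]_N | forall i, A i (v ord0 i)].
Proof.
move=> mA; rewrite (_ : mkset _ = \bigcap_(i in [set: 'I_N])
    (fun v : 'rV[R]_N => v ord0 i : measurableTypeR R) @^-1` A i).
  apply: fin_bigcap_measurable => // i _.
  by rewrite -[X in measurable X]setTI; exact: measurable_row_coord.
by apply/seteqP; split => v Av i; [move=> _; exact: Av | exact: Av].
Qed.

Lemma measurable_ocbox a b : measurable (ocbox a b).
Proof.
by apply: (@measurable_coord_box (fun i => `]a ord0 i, b ord0 i]%classic)) => i;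
  exact: measurable_itv.
Qed.

Lemma ocboxes_setI : setI_closed ocboxes.
Proof.
move=> _ _ [a _ [b _ <-]] [c _ [d _ <-]].
exists (\row_i Num.max (a ord0 i) (c ord0 i)) => //.
exists (\row_i Num.min (b ord0 i) (d ord0 i)) => //.
apply/seteqP; split => [v h|v [h1 h2] i].
  by split=> i; have := h i; rewrite /= !mxE !in_itv/= gt_max le_min;
    move=> /andP[/andP[h1 h2] /andP[h3 h4]]; rewrite ?(h1, h2, h3, h4).
have := h1 i; have := h2 i; rewrite /= !mxE !in_itv/= gt_max le_min.
by move=> /andP[-> ->] /andP[-> ->].
Qed.

Lemma ocbox_cover :
  \bigcup_k ocbox (const_mx (- k%:R)) (const_mx k%:R) = [set: 'rV[R]_N].
Proof.
apply/seteqP; split => // v _.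
have [k hk] : exists k : nat, forall i, `|v ord0 i| < k%:R.
  exists (\max_i (Num.bound `|v ord0 i|)) => i.
  apply: (lt_le_trans (archi_boundP (normr_ge0 (v ord0 i)))).
  by rewrite ler_nat; exact: (leq_bigmax_cond _ (P := xpredT)).
exists k => // i; have := hk i; rewrite /= !mxE in_itv/= ltr_norml => /andP[-> /ltW ->].
by [].
Qed.

Lemma measurable_ocboxes :
  (@measurable _ 'rV[R]_N : set (set 'rV[R]_N)) = <<s ocboxes >>.
Proof.
apply/seteqP; split; last first.
  apply: smallest_sub; first exact: sigma_algebra_measurable.
  by move=> _ [a _ [b _ <-]]; exact: measurable_ocbox.
apply: smallest_sub; first exact: smallest_sigma_algebra.
rewrite -bigcup_seq/=; apply: bigcup_sub => i _ A [B mB <-] /=.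
rewrite setTI; move: B mB.
suff : (@measurable _ (measurableTypeR R)) `<=`
    [set B | <<s ocboxes >> ((fun v : 'rV[R]_N => v ord0 i) @^-1` B)].
  by move=> h B /h.
have [h0 hC hU] := smallest_sigma_algebra [set: 'rV[R]_N] ocboxes.
apply: smallest_sub.
  split => [|B mB|F mF] /=.
  - by rewrite preimage_set0.
  - by rewrite setTD -preimage_setC -setTD; exact: hC.
  - by rewrite preimage_bigcup; exact: hU.
move=> _ [[x y] _ <-] /=.
(* A slab in direction i is exhausted by boxes whose other sides are ]-k, k]. *)
rewrite (_ : _ @^-1` _ = \bigcup_k ocbox
   (\row_j if j == i then x else - k%:R) (\row_j if j == i then y else k%:R)).
  apply: hU => k; apply: sub_gen_smallest; eexists => //; eexists => //.
apply/seteqP; split => [v /= vi|v [k _ /(_ i)]]; last first.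
  by rewrite /= !mxE eqxx.
have [k _ hk] : (\bigcup_k ocbox (const_mx (- k%:R)) (const_mx k%:R)) v.
  by rewrite ocbox_cover.
exists k => // j; have := hk j; rewrite /= !mxE; case: eqP => // -> _.
exact: vi.
Qed.

End oc_boxes.

Section affine_invariance.
Context {R : realType} (N : nat).
Implicit Types (x v : 'rV[R]_N) (e : R).

Lemma measurable_sign_affine x e :
  measurable_fun [set: 'rV[R]_N] (fun v => x + e *: v).
Proof.
apply: measurable_fun_row => i.
under eq_fun do rewrite !mxE.
apply: measurable_funD => //; apply: measurable_funM => //.
exact: measurable_row_coord.
Qed.

(** The condition on [e] treats translations and reflections together. A reflection turns ]a, b]
    into an interval closed on the left, of the same length. *)
Lemma lebesgue_measure_sign_affine (x e a b : R) : e ^+ 2 = 1 ->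
  lebesgue_measure ((fun t : measurableTypeR R => x + e * t) @^-1` `]a, b]%classic) =
  lebesgue_measure (`]a, b]%classic : set (measurableTypeR R)).
Proof.
move=> /eqP; rewrite sqrf_eq1 => /orP[]/eqP ->.
  rewrite (_ : _ @^-1` _ = `](a - x), (b - x)]%classic).
    rewrite !lebesgue_measure_itv/= !lte_fin ltrD2r; congr (if _ then _ else _).
    by rewrite -!EFinB; congr EFin; ring.
  by apply/seteqP; split => t/=; rewrite !in_itv/= mul1r; lra.
rewrite (_ : _ @^-1` _ = `[(x - b), (x - a)[%classic).
  rewrite !lebesgue_measure_itv/= !lte_fin ltrD2l ltrN2; congr (if _ then _ else _).
  by rewrite -!EFinB; congr EFin; ring.
by apply/seteqP; split => t/=; rewrite !in_itv/= mulN1r; lra.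
Qed.

Lemma lebesgue_row_ocbox (a b : 'rV[R]_N) : lebesgue_row N (ocbox a b) =
  (\prod_(i < N) @lebesgue_measure R `]a ord0 i, b ord0 i]%classic)%E.
Proof.
by apply: (@lebesgue_row_box _ _ (fun i => `]a ord0 i, b ord0 i]%classic)) => i;
  exact: measurable_itv.
Qed.

Lemma lebesgue_row_ocbox_lty (a b : 'rV[R]_N) :
  (lebesgue_row N (ocbox a b) < +oo)%E.
Proof.
rewrite lebesgue_row_ocbox -ge0_fin_numE.
  by apply: prode_fin_num => i _; rewrite lebesgue_measure_itv/=; case: ifP.
by apply: prode_ge0 => i _; exact: measure_ge0.
Qed.

(** The measure and its pushforward agree on boxes, which generate, are stable under intersection,
    and contain an exhausting sequence of finite measure; uniqueness of measures concludes. *)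
Lemma lebesgue_row_sign_affine x e (A : set 'rV[R]_N) : e ^+ 2 = 1 ->
  measurable A ->
  lebesgue_row N ((fun v => x + e *: v) @^-1` A) = lebesgue_row N A.
Proof.
move=> e1 mA.
have mf := measurable_sign_affine x e.
have := @measure_unique _ R _ (@ocboxes R N)
  (fun k => ocbox (const_mx (- k%:R)) (const_mx k%:R)) (@measurable_ocboxes R N)
  (@ocboxes_setI _ _) _ (@ocbox_cover _ _)
  (lebesgue_row N) (pushforward (lebesgue_row N) (fun v => x + e *: v))
  _ _ _ mA.
move=> -> //.
- by move=> k; exists (const_mx (- k%:R)) => //; exists (const_mx k%:R).
- move=> _ [a _ [b _ <-]].
  transitivity (lebesgue_row N [set v : 'rV[R]_N | forall i,
      ((fun t : measurableTypeR R => x ord0 i + e * t) @^-1`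
        `]a ord0 i, b ord0 i]%classic) (v ord0 i)]).
    apply: (eq_trans (lebesgue_row_ocbox a b)); apply/esym.
    have mP i : measurable ((fun t : measurableTypeR R => x ord0 i + e * t) @^-1`
        `]a ord0 i, b ord0 i]%classic).
      rewrite -[X in measurable X]setTI; apply: measurable_funD => //.
    apply: (eq_trans (lebesgue_row_box mP)).
    by apply: eq_bigr => i _; rewrite lebesgue_measure_sign_affine.
  congr (lebesgue_row N _).
  by apply/seteqP; split => v h i; have := h i; rewrite /= !mxE.
- by move=> k; exact: lebesgue_row_ocbox_lty.
Qed.

Lemma ge0_integral_sign_affine x e (D : set 'rV[R]_N) (f : 'rV[R]_N -> \bar R) :
  e ^+ 2 = 1 -> measurable D -> measurable_fun [set: _] f ->
  (forall v, 0 <= f v)%E ->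
  (\int[lebesgue_row N]_(v in D) f v =
   \int[lebesgue_row N]_(v in (fun v => x + e *: v)%R @^-1` D) f (x + e *: v)%R)%E.
Proof.
move=> e1 mD mf f0; have mT := measurable_sign_affine x e.
rewrite -(ge0_integral_pushforward mT)//; last exact: measurable_funTS.
by apply: eq_measure_integral => A mA AD; exact/esym/lebesgue_row_sign_affine.
Qed.

(** The integral is by definition the difference of the integrals of the two parts, so the
    nonnegative case applies to each part and integrability does not enter. *)
Lemma integral_sign_affine x e (D : set 'rV[R]_N) (f : 'rV[R]_N -> \bar R) :
  e ^+ 2 = 1 -> measurable D -> measurable_fun [set: _] f ->
  (\int[lebesgue_row N]_(v in D) f v =
   \int[lebesgue_row N]_(v in (fun v => x + e *: v)%R @^-1` D) f (x + e *: v)%R)%E.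
Proof.
move=> e1 mD mf; rewrite integralE [RHS]integralE; congr (_ - _)%E.
  apply: (eq_trans (@ge0_integral_sign_affine x e D (f^\+)%E e1 mD _ _)) => [|v|].
  - exact: measurable_funepos.
  - exact: funepos_ge0.
  - by apply: eq_integral => v _; rewrite !funeposE.
apply: (eq_trans (@ge0_integral_sign_affine x e D (f^\-)%E e1 mD _ _)) => [|v|].
- exact: measurable_funeneg.
- exact: funeneg_ge0.
- by apply: eq_integral => v _; rewrite !funenegE.
Qed.

End affine_invariance.

(** * Integrability of the truncated Riesz kernel *)

Lemma le_integrable_real d (T : measurableType d) (R : realType)
    (mu : {measure set T -> \bar R}) (D : set T) (f g : T -> R) :
  measurable D -> measurable_fun D f -> (forall x, D x -> `|f x| <= g x) ->
  mu.-integrable D (EFin \o g) -> mu.-integrable D (EFin \o f).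
Proof.
move=> mD mf fg; apply: le_integrable => //; first exact/measurable_EFinP.
by move=> x Dx /=; rewrite !lee_fin (le_trans (fg x Dx))// ler_norm.
Qed.

Section dyadic.
Context {R : realType}.

Lemma dyadic_bounds (x : R) : 1 <= x ->
  exists k : nat, 2 ^+ k <= x < 2 ^+ k.+1.
Proof.
move=> x1.
have ex : exists k : nat, x < 2 ^+ k.+1.
  exists (Num.bound x); apply: (lt_le_trans (archi_boundP (le_trans ler01 x1))).
  by rewrite -natrX ler_nat ltnW// (ltn_trans (ltnSn _))// ltn_expl.
case: (ex_minnP ex) => -[|k] hk min; first by exists 0%N; rewrite expr0 x1.
exists k.+1; rewrite hk andbT leNgt; apply/negP => /min.
by rewrite ltnn.
Qed.

Lemma nneseries_le_geometric_lty (u : nat -> \bar R) (C z : R) :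
  0 <= C -> 0 < z < 1 -> (forall k, (0 <= u k <= (C * z ^+ k)%:E)%E) ->
  (\sum_(0 <= k <oo) u k < +oo)%E.
Proof.
move=> C0 /andP[z0 z1] uC; apply: (@le_lt_trans _ _ (C / (1 - z))%:E); last first.
  exact: ltry.
apply: lime_le.
  by apply: is_cvg_nneseries => k _ _; have /andP[] := uC k.
apply: nearW => n.
apply: (@le_trans _ _ (\sum_(0 <= k < n) (C * z ^+ k)%:E)%E).
  by apply: lee_sum => k _; have /andP[] := uC k.
rewrite sumEFin lee_fin; apply: geometric_le_lim => //.
by rewrite gtr0_norm.
Qed.

End dyadic.

(** The size of a symmetric second difference quotient of a bounded C^2 function: r^(2-e) near 0 and
    r^(-e) at infinity. *)
Definition riesz {R : realType} (e : R) (r : R) : R :=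
  Num.min 1 (r ^+ 2) / r `^ e.

Section riesz_integrable.
Context d (T : measurableType d) (R : realType) (mu : {measure set T -> \bar R}).
Variables (rho : T -> R) (n : nat) (C s : R).
Hypotheses (mrho : measurable_fun [set: T] rho) (rho0 : forall x, 0 <= rho x).
Hypothesis C0 : 0 <= C.
Hypothesis mu_ball : forall r, 0 < r ->
  (mu [set x | (rho x <= r)%R] <= (C * r ^+ n)%:E)%E.
Hypothesis s01 : 0 < s < 1.

Lemma riesz_ge0 (e r : R) : 0 <= riesz e r.
Proof. by rewrite /riesz mulr_ge0// ?invr_ge0 ?powR_ge0// le_min ler01 sqr_ge0. Qed.

Let e := n%:R + 2 * s.
Let Q : R := 2 `^ e.
Let W : R := 2 `^ (2 * s).

Let e0 : 0 < e. Proof. by rewrite /e ltr_wpDl// mulr_gt0//; case/andP: s01. Qed.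
Let Q0 : 0 < Q. Proof. exact: powR_gt0. Qed.
Let QW : Q = 2 ^+ n * W.
Proof. by rewrite /Q /e powRD ?powR_mulrn//; apply/implyP. Qed.

Let powR_gt1 (x r : R) : 1 < x -> 0 < r -> 1 < x `^ r.
Proof.
move=> x1 r0; have := @gt0_ltr_powR _ r r0 1 x.
by rewrite !nnegrE ler01 powR1; apply => //; exact: ltW (lt_trans ltr01 x1).
Qed.

Let W1 : 1 < W.
Proof. by rewrite powR_gt1 ?ltr1n// mulr_gt0//; case/andP: s01. Qed.

Let W4 : W < 4.
Proof.
have -> : 4 = W * 2 `^ (2 * (1 - s)) :> R.
  rewrite -powRD ?pnatr_eq0 ?implybT// -mulrDr addrC subrK mulr1.
  by rewrite powR_mulrn// -natrX.
rewrite ltr_pMr ?powR_gt0// powR_gt1 ?ltr1n// mulr_gt0//.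
by rewrite subr_gt0; case/andP: s01.
Qed.

Let pow2 k : (2 ^+ k) `^ e = Q ^+ k.
Proof. by rewrite -powR_mulrn// -powRrM mulrC powRrM powR_mulrn// ltW. Qed.

(** On the shell 2^k <= rho < 2^(k+1) the kernel is at most [a k]; on 2^-(k+1) < rho <= 2^-k it is
    at most [b k]. The shells are enlarged to balls, whose measure is what [mu_ball] controls. *)
Let A k := [set x | (rho x <= 2 ^+ k.+1)%R].
Let B k := [set x | (rho x <= (2 ^+ k)^-1)%R].
Let a k := (Q ^+ k)^-1.
Let b k := (4 ^+ k)^-1 * Q ^+ k.+1.

Let mA k : measurable (A k).
Proof. by rewrite -[A k]setTI; exact: measurable_fun_le. Qed.
Let mB k : measurable (B k).
Proof. by rewrite -[B k]setTI; exact: measurable_fun_le. Qed.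

Let riesz_large x : 1 <= rho x -> exists k, A k x /\ riesz e (rho x) <= a k.
Proof.
move=> /dyadic_bounds[k /andP[kx xk]]; exists k; split; first exact: ltW.
rewrite /riesz /a -pow2 -[leRHS]mul1r ler_pM ?invr_ge0 ?powR_ge0//.
- by rewrite le_min ler01 sqr_ge0.
- by rewrite ge_min lexx.
- rewrite lef_pV2 ?posrE ?powR_gt0 ?exprn_gt0//.
    by rewrite ge0_ler_powR ?nnegrE// ?ltW// exprn_gt0.
  by rewrite (lt_le_trans _ kx)// exprn_gt0.
Qed.

Let riesz_small x : 0 < rho x < 1 -> exists k, B k x /\ riesz e (rho x) <= b k.
Proof.
move=> /andP[x0 x1].
have /dyadic_bounds[k /andP[kx xk]] : 1 <= (rho x)^-1 by rewrite invf_ge1// ltW.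
have xk' : rho x <= (2 ^+ k)^-1.
  by rewrite -(invrK (rho x)) lef_pV2 ?posrE ?invr_gt0// exprn_gt0.
exists k; split => //.
rewrite /riesz /b -pow2 ler_pM ?invr_ge0 ?powR_ge0//.
- by rewrite le_min ler01 sqr_ge0.
- apply: (@le_trans _ _ (rho x ^+ 2)); first by rewrite ge_min lexx orbT.
  rewrite (_ : (4 ^+ k)^-1 = ((2 ^+ k)^-1 : R) ^+ 2).
    by rewrite lerXn2r ?nnegrE// ?ltW// invr_ge0 exprn_ge0.
  by rewrite exprVn -exprM mulnC exprM (_ : 2 ^+ 2 = 4 :> R)// -natrX.
- rewrite -[leLHS]mulr1 ler_pdivrMl ?powR_gt0// -powRM ?ltW// ?exprn_gt0//.
  by rewrite powR_gt1// -ltr_pdivrMl// mulr1.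
Qed.

Let g k x := ((a k)%:E * (\1_(A k) x)%:E + (b k)%:E * (\1_(B k) x)%:E)%E.

Let a_ge0 k : 0 <= a k. Proof. by rewrite invr_ge0 exprn_ge0// ltW. Qed.
Let b_ge0 k : 0 <= b k.
Proof. by rewrite mulr_ge0 ?invr_ge0 ?exprn_ge0// ltW. Qed.
Let g_ge0 k x : (0 <= g k x)%E.
Proof. by rewrite adde_ge0// mule_ge0// lee_fin. Qed.

Let mg k : measurable_fun [set: T] (g k).
Proof.
by apply: emeasurable_funD; apply: emeasurable_funM => //;
  exact/measurable_EFinP/measurable_indic.
Qed.

Let riesz_le_series x : ((riesz e (rho x))%:E <= \sum_(0 <= k <oo) g k x)%E.
Proof.
have le_g k : (g k x <= \sum_(0 <= k <oo) g k x)%E.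
  apply: (@le_trans _ _ (\sum_(0 <= i < k.+1) g i x)%E).
    by rewrite big_nat_recr//= leeDr//; exact: sume_ge0.
  exact: nneseries_lim_ge.
have [x1|x1] := leP 1 (rho x).
  have [k [Ak rk]] := riesz_large x1; apply: le_trans (le_g k).
  rewrite /g -!EFinM -EFinD lee_fin (le_trans rk)//.
  by rewrite [\1_(A k) x]indicE mem_set// mulr1 lerDl mulr_ge0.
(* At rho = 0 the kernel has the default value 0, since 0^e = 0 and the inverse of 0 is 0. *)
have [x0|x0] := eqVneq (rho x) 0.
  by rewrite /riesz x0 powR0 ?gt_eqF// invr0 mulr0; exact: nneseries_ge0.
have [|k [Bk rk]] := @riesz_small x; first by rewrite x1 lt_def x0 rho0.
apply: le_trans (le_g k).
rewrite /g -!EFinM -EFinD lee_fin (le_trans rk)//.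
by rewrite [\1_(B k) x]indicE mem_set// mulr1 lerDr mulr_ge0.
Qed.

(** The outer terms decay with ratio 1/W and the inner ones with ratio W/4, where W = 2^(2s). Both
    ratios are below 1 because 0 < s < 1. *)
Let z := Num.max W^-1 (W / 4).
Let z01 : 0 < z < 1.
Proof.
have W0 : 0 < W by rewrite (lt_trans _ W1).
rewrite /z lt_max invr_gt0 W0/= gt_max invf_lt1// W1/= ltr_pdivrMr// mul1r.
exact: W4.
Qed.

Let int_g k : (0 <= \int[mu]_x g k x <= ((C * (2 ^+ n + Q)) * z ^+ k)%:E)%E.
Proof.
rewrite integral_ge0//=.
have mi (D : set T) : measurable D -> measurable_fun [set: T] (fun x => (\1_D x)%:E : \bar R).
  by move=> mD; exact/measurable_EFinP/measurable_indic.
rewrite ge0_integralD//; last 4 first.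
- by move=> x _; rewrite mule_ge0// lee_fin.
- by apply: emeasurable_funM => //; exact: mi.
- by move=> x _; rewrite mule_ge0// lee_fin.
- by apply: emeasurable_funM => //; exact: mi.
rewrite !ge0_integralZl_EFin//; [|exact: mi|exact: mi].
rewrite !integral_indic// !setIT.
have W0 : 0 < W by rewrite (lt_trans _ W1).
have [Wi0 Wd0] : 0 <= W^-1 /\ 0 <= W / 4 by rewrite invr_ge0 divr_ge0 ltW.
have [Wz W4z] : W^-1 <= z /\ W / 4 <= z by rewrite /z !le_max !lexx orbT.
have z0 : 0 <= z by case/andP: z01 => /ltW.
rewrite mulrDr mulrDl EFinD; apply: leeD.
  apply: (@le_trans _ _ ((a k)%:E * (C * (2 ^+ k.+1) ^+ n)%:E)%E).
    by rewrite lee_wpmul2l ?lee_fin//; exact: mu_ball.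
  rewrite -EFinM lee_fin /a QW exprMn -!exprM mulSn exprD [(n * k)%N]mulnC.
  have -> : (2 ^+ (k * n) * W ^+ k)^-1 * (C * (2 ^+ n * 2 ^+ (k * n))) =
            C * 2 ^+ n * W^-1 ^+ k.
    by rewrite exprVn; field; rewrite !gt_eqF// exprn_gt0.
  by rewrite ler_wpM2l ?mulr_ge0 ?exprn_ge0// lerXn2r ?nnegrE.
apply: (@le_trans _ _ ((b k)%:E * (C * ((2 ^+ k)^-1) ^+ n)%:E)%E).
  rewrite lee_wpmul2l ?lee_fin//; apply: mu_ball.
  by rewrite invr_gt0 exprn_gt0.
rewrite -EFinM lee_fin /b exprS {2}QW exprMn exprVn -!exprM [(n * k)%N]mulnC.
have -> : (4 ^+ k)^-1 * (Q * (2 ^+ (k * n) * W ^+ k)) * (C / 2 ^+ (k * n)) =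
          C * Q * (W / 4) ^+ k.
  by rewrite [(W / 4) ^+ k]exprMn exprVn; field; rewrite !gt_eqF// exprn_gt0.
by rewrite ler_wpM2l ?mulr_ge0 ?(ltW Q0)// lerXn2r ?nnegrE.
Qed.

Lemma measurable_riesz (c : R) :
  measurable_fun [set: T] (fun x => riesz c (rho x)).
Proof.
apply: measurable_funM; first by apply: measurable_minr => //; exact: measurable_funX.
under eq_fun do rewrite -powRN.
exact: (measurableT_comp (measurable_powR _)).
Qed.

(** Polynomial growth of balls replaces polar coordinates, and the same statement serves the
    Euclidean norm on R^N and the absolute value on the line. *)
Lemma integrable_riesz : mu.-integrable [set: T]
  (fun x => (riesz (n%:R + 2 * s) (rho x))%:E).
Proof.
apply/integrableP; split; first exact/measurable_EFinP/measurable_riesz.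
under eq_integral do rewrite gee0_abs ?lee_fin ?riesz_ge0//.
apply: (@le_lt_trans _ _ (\int[mu]_x \sum_(0 <= k <oo) g k x)%E).
  apply: ge0_le_integral => //.
  - by move=> x _; rewrite lee_fin riesz_ge0.
  - exact/measurable_EFinP/measurable_riesz.
  - by apply: ge0_emeasurable_sum.
rewrite integral_nneseries//.
apply: (@nneseries_le_geometric_lty _ _ (C * (2 ^+ n + Q)) z) => //.
by rewrite mulr_ge0// addr_ge0// ?exprn_ge0 ?ltW.
Qed.

End riesz_integrable.

Section euclidean_norm.
Context {R : realType} (N : nat).
Implicit Types h : 'rV[R]_N.

Lemma enorm_ge0 h : 0 <= enorm h. Proof. exact: sqrtr_ge0. Qed.

Lemma enormN h : enorm (- h) = enorm h.
Proof. by congr Num.sqrt; apply: eq_bigr => i _; rewrite mxE sqrrN. Qed.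

Lemma coord_le_enorm h i : `|h ord0 i| <= enorm h.
Proof.
rewrite -(ler_sqr (normr_ge0 _) (enorm_ge0 h))//.
rewrite -normrX ger0_norm ?sqr_ge0// sqr_sqrtr; last first.
  by apply: sumr_ge0 => j _; exact: sqr_ge0.
by rewrite (bigD1 i)//= lerDl sumr_ge0// => j _; exact: sqr_ge0.
Qed.

Lemma enorm_gt0 h i : h ord0 i != 0 -> 0 < enorm h.
Proof. by move=> h0; rewrite (lt_le_trans _ (coord_le_enorm h i))// normr_gt0. Qed.

Lemma measurable_enorm : measurable_fun [set: 'rV[R]_N] (@enorm R N).
Proof.
have ms : measurable_fun [set: R] (@Num.sqrt R).
  by apply: continuous_measurable_fun; exact: sqrt_continuous.
apply: (measurableT_comp ms).
by apply: measurable_sum => i; apply: measurable_funX; exact: measurable_row_coord.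
Qed.

(** The Euclidean ball lies in the cube of side 2r. *)
Lemma lebesgue_row_ball (r : R) : 0 < r ->
  (lebesgue_row N [set h : 'rV[R]_N | (enorm h <= r)%R] <= (2 ^+ N * r ^+ N)%:E)%E.
Proof.
move=> r0; have mI (i : 'I_N) : measurable (`[- r, r]%classic : set (measurableTypeR R)).
  exact: measurable_itv.
apply: (@le_trans _ _ (lebesgue_row N [set h : 'rV[R]_N | forall i, `[- r, r]%classic (h ord0 i)])).
  apply: le_measure; rewrite ?inE.
  - by rewrite -[X in measurable X]setTI; apply: measurable_fun_le => //; exact: measurable_enorm.
  - exact: (measurable_coord_box mI).
  - move=> h /= hr i; rewrite in_itv/= -ler_norml; exact: le_trans (coord_le_enorm h i) hr.
rewrite (lebesgue_row_box mI) (eq_bigr (fun=> (2 * r)%:E)); last first.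
  move=> i _; rewrite lebesgue_measure_itv/= lte_fin gtrN// -EFinB; congr EFin; ring.
by rewrite prodEFin prodr_const card_ord exprMn.
Qed.

Lemma integrable_riesz_enorm (s : R) : 0 < s < 1 ->
  (lebesgue_row N).-integrable [set: 'rV[R]_N]
    (fun h => (riesz (N%:R + 2 * s) (enorm h))%:E).
Proof.
move=> s01; apply: (integrable_riesz measurable_enorm enorm_ge0 _ lebesgue_row_ball s01).
by rewrite exprn_ge0.
Qed.

End euclidean_norm.

Lemma continuous_enorm_sub {R : realType} (N : nat) (x : 'rV[R]_N) :
  continuous (fun y : 'rV[R]_N => enorm (y - x)).
Proof.
have csq (d : R) : continuous (fun t : R => (t - d) ^+ 2).
  move=> t; apply: (@continuous_comp _ _ _ (fun t : R => t - d) (fun t : R => t ^+ 2));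
    last exact: exprn_continuous.
  by apply: cvgB; [exact: cvg_id|exact: cvg_cst].
have c1 i : continuous (fun y : 'rV[R]_N => (y - x) ord0 i ^+ 2).
  rewrite (_ : (fun y : 'rV[R]_N => _) = (fun t : R => (t - x ord0 i) ^+ 2) \o
    (fun y : 'rV[R]_N => y ord0 i)).
    by move=> z; apply: continuous_comp; [exact: coord_continuous|exact: csq].
  by apply/funext => w; rewrite /= !mxE.
have cs : continuous (fun y : 'rV[R]_N => \sum_(i < N) (y - x) ord0 i ^+ 2).
  elim: (index_enum _) => [|i r IH].
    rewrite (_ : (fun y => _) = cst 0); first exact: cst_continuous.
    by apply/funext => y; rewrite big_nil.
  rewrite (_ : (fun y => _) = (fun y => (y - x) ord0 i ^+ 2) \+
    (fun y => \sum_(j <- r) (y - x) ord0 j ^+ 2)).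
    by move=> y; apply: continuousD; [exact: c1 | exact: IH].
  by apply/funext => y; rewrite big_cons.
move=> y; apply: (@continuous_comp _ _ _
  (fun y : 'rV[R]_N => \sum_(i < N) (y - x) ord0 i ^+ 2) Num.sqrt).
  exact: cs.
exact: sqrt_continuous.
Qed.

(** * Positivity of the constant *)

Section Gamma_positive.
Context {R : realType}.
Local Notation mu := (@lebesgue_measure R).

Let igamma (x t : R) : R := t `^ (x - 1) * expR (- t).

Let measurable_igamma x (D : set R) : measurable_fun D (igamma x).
Proof.
apply: measurable_funTS; apply: measurable_funM; first exact: measurable_powR.
apply: (measurableT_comp (@measurable_expR R)).
exact: measurable_funN.
Qed.

Lemma integrable_riesz_abs (s : R) : 0 < s < 1 ->
  mu.-integrable [set: R] (fun t => (riesz (1 + 2 * s) `|t|)%:E).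
Proof.
move=> s01; apply: (@integrable_riesz _ _ _ mu (fun t => `|t|) 1 2 s) => //.
- exact: normr_measurable.
move=> r r0; rewrite expr1 (_ : mkset _ = `[- r, r]%classic).
  apply: (@le_trans _ _ (lebesgue_measure
    (`[- r, r]%classic : set (measurableTypeR R)))) => //.
  by rewrite lebesgue_measure_itv/= lte_fin gtrN// -EFinB lee_fin; lra.
by apply/seteqP; split => t /=; rewrite in_itv/= ler_norml.
Qed.

Let igamma_le_riesz x : 0 < x -> exists s c : R, [/\ 0 < s < 1, 0 <= c &
  forall t, 0 < t -> igamma x t <= c * riesz (1 + 2 * s) `|t|].
Proof.
(* With s >= 1 - x/2 one has t^(x-1) <= t^(1-2s) for 0 < t < 1, which is the kernel near 0; the
   value 1/2 keeps s positive. *)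
move=> x0; pose s : R := Num.max 2^-1 (1 - x / 2).
have s2 : 2^-1 <= s by rewrite /s le_max lexx.
have sx : 1 - x / 2 <= s by rewrite /s le_max lexx orbT.
have s1 : s < 1 by rewrite /s gt_max; apply/andP; split; lra.
have s0 : 0 < s by lra.
(* For t >= 1 the bound exp t >= t^(m+1) / (m+1)! absorbs the power t^(x+2s). *)
pose m := Num.bound (x + 2 * s).
have xm : x + 2 * s <= m.+1%:R.
  apply: ltW; apply: (lt_le_trans (archi_boundP _)); first lra.
  by rewrite ler_nat.
exists s, (m.+1`!%:R + 1); split; rewrite ?s0//.
move=> t t0; rewrite /igamma /riesz (gtr0_norm t0) mulrA.
have pt : 0 < t `^ (1 + 2 * s) by rewrite powR_gt0.
rewrite ler_pdivlMr// mulrAC -powRD; last by rewrite (gt_eqF t0) implybT.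
rewrite (_ : x - 1 + (1 + 2 * s) = x + 2 * s); last by ring.
have [t1|t1] := leP 1 t.
  rewrite (elimT min_idPl); last by rewrite exprn_ege1.
  rewrite mulr1 expRN ler_pdivrMr ?expR_gt0//.
  apply: (@le_trans _ _ (t ^+ m.+1)).
    by rewrite -powR_mulrn ?(ltW t0)// ler_powR.
  have := @expR_ge1Dxn _ t m (ltW t0) => h.
  have f0 : 0 < m.+1`!%:R :> R by rewrite ltr0n fact_gt0.
  have : t ^+ m.+1 / m.+1`!%:R <= expR t by lra.
  rewrite ler_pdivrMr// mulrC => /le_trans; apply.
  by rewrite ler_wpM2r ?expR_ge0//; lra.
rewrite (elimT min_idPr); last by rewrite exprn_ile1 ?(ltW t0) ?(ltW t1).
apply: (@le_trans _ _ (t ^+ 2)).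
  rewrite -[leRHS]mulr1 ler_pM ?powR_ge0 ?expR_ge0//.
    by rewrite -powR_mulrn ?(ltW t0)// ger_powR ?t0 ?(ltW t1)//; lra.
  by rewrite expR_le1; lra.
by rewrite -[leLHS]mul1r ler_wpM2r ?sqr_ge0// lerDr ler0n.
Qed.

(** Convergence comes first, since the real-valued integral is 0 by default when the extended one is
    infinite. The interval [1, 2] then gives a positive lower bound. *)
Lemma Gamma_gt0 (x : R) : 0 < x -> 0 < Gamma x.
Proof.
move=> x0; have mD : measurable (`]0%R, +oo[%classic : set R) by exact: measurable_itv.
have g0 (t : R) : 0 <= igamma x t by rewrite mulr_ge0 ?powR_ge0 ?expR_ge0.
have ig : mu.-integrable `]0, +oo[%classic (EFin \o igamma x).
  have [s [c [s01 c0 h]]] := igamma_le_riesz x0.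
  apply: (@le_integrable_real _ _ R mu _ (igamma x) (fun t => c * riesz (1 + 2 * s) `|t|)) => //.
      exact: measurable_igamma.
    by move=> t /=; rewrite in_itv/= andbT => t0; rewrite ger0_norm// h.
  rewrite (_ : _ \o _ = fun t => (c%:E * (riesz (1 + 2 * s) `|t|)%:E)%E)//.
  apply: integrableZl => //.
  by apply: (integrableS _ _ _ (integrable_riesz_abs s01)) => //; exact: measurableT.
rewrite /Gamma /Rintegral fine_gt0//; apply/andP; split; last exact: integrable_lty.
(* On [1, 2] one has t^(x-1) >= 1/t >= 1/2 and exp(-t) >= exp(-2). *)
pose c := expR (- 2) / 2 : R.
have c0 : 0 < c by rewrite divr_gt0// expR_gt0.
apply: (@lt_le_trans _ _ (\int[mu]_(t in `[1%R, 2%R]) (cst c%:E t))%E).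
  rewrite integral_cst//= lebesgue_measure_itv/= lte_fin ltr1n.
  by rewrite -EFinB -EFinM lte_fin mulr_gt0//; lra.
apply: (@le_trans _ _ (\int[mu]_(t in `[1%R, 2%R]) (igamma x t)%:E)%E).
  apply: ge0_le_integral => //.
  - by move=> t _; rewrite lee_fin ltW.
  - by apply/measurable_EFinP; exact: measurable_igamma.
  - move=> t /=; rewrite in_itv/= => /andP[t1 t2].
    rewrite lee_fin /c mulrC ler_pM ?expR_ge0//.
      apply: (@le_trans _ _ (t `^ (- 1))).
        rewrite powR_inv1; last lra.
        by rewrite lef_pV2 ?posrE//; lra.
      by rewrite ler_powR//; lra.
    by rewrite ler_expR; lra.
apply: ge0_subset_integral => //.
- by apply/measurable_EFinP; exact: measurable_igamma.
- by move=> t _; rewrite lee_fin.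
- by move=> t /=; rewrite !in_itv/= => /andP[t1 _]; rewrite andbT; lra.
Qed.

Lemma fraclap_const_gt0 (N : nat) (s : R) : 0 < s < 1 -> 0 < fraclap_const N s.
Proof.
move=> /andP[s0 s1]; rewrite /fraclap_const.
by rewrite !mulr_gt0 ?invr_gt0 ?Gamma_gt0 ?powR_gt0 ?pi_gt0 ?subr_gt0//
  ?(lt_trans s1) ?ltr1n// ltr_wpDl.
Qed.

End Gamma_positive.

(** * Smooth bumps *)

Section smooth_functions.
Context {R : realType}.
Implicit Types f g df : R -> R.

(** C^k on the line, with the derivative as a witness so that closure properties follow by induction
    on k. *)
Fixpoint smooth (k : nat) f : Prop :=
  match k with
  | 0 => continuous f
  | k'.+1 => exists2 df, forall x, is_derive x (1 : R) f (df x) & smooth k' df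
  end.

Lemma is_derive_continuous f df : (forall x, is_derive x (1 : R) f (df x)) ->
  continuous f.
Proof.
move=> h x; apply: differentiable_continuous; apply/derivable1_diffP.
exact: ex_derive.
Qed.

Lemma smooth_pred k f : smooth k.+1 f -> smooth k f.
Proof.
elim: k f => [f [df h _]|k IH f [df h /IH]]; first exact: is_derive_continuous h.
by exists df.
Qed.

Lemma smooth_continuous k f : smooth k f -> continuous f.
Proof. by elim: k f => // k IH f /smooth_pred/IH. Qed.

(** The derivatives of products, of affine substitutions and of [flat] are all put in this form,
    with coefficients 0 or 1 where necessary. *)
Lemma smooth_lin k (a b : R) f g : smooth k f -> smooth k g ->
  smooth k (fun x => a * f x + b * g x).
Proof.
elim: k f g => [f g cf cg x|k IH f g [df hf sf] [dg hg sg]].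
  by apply: cvgD; apply: cvgMl_tmp; [exact: cf|exact: cg].
exists (fun x => a * df x + b * dg x); last exact: IH.
move=> x; have := is_deriveD (is_deriveZ a (hf x)) (is_deriveZ b (hg x)).
exact.
Qed.

Lemma smooth_mul k f g : smooth k f -> smooth k g ->
  smooth k (fun x => f x * g x).
Proof.
elim: k f g => [f g cf cg x|k IH f g]; first by apply: cvgM; [exact: cf|exact: cg].
move=> /[dup] sf [df hf sdf] /[dup] sg [dg hg sdg].
exists (fun x => 1 * (f x * dg x) + 1 * (g x * df x)).
  by move=> x; apply: (is_derive_eq (is_deriveM (hf x) (hg x))); rewrite !mul1r.
by apply: smooth_lin; apply: IH => //; exact: smooth_pred.
Qed.

Lemma smooth_affine k f (c d : R) : smooth k f -> smooth k (fun x => f (c * x + d)).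
Proof.
elim: k f => [f cf x|k IH f [df hf sf]].
  apply: continuous_comp; last exact: cf.
  by apply: cvgD; [apply: cvgMl_tmp; exact: cvg_id | exact: cvg_cst].
exists (fun x => c * df (c * x + d) + 0 * df (c * x + d)).
  move=> x; rewrite mul0r addr0.
  have ha : is_derive x (1 : R) (fun x : R => c * x + d) c.
    have := is_deriveD (is_deriveZ c (is_derive_id x (1 : R))) (is_derive_cst d x (1 : R)).
    by move=> h; apply: (is_derive_eq h); rewrite addr0 [_ *: _]mulr1.
  apply: (is_derive_eq (@is_derive1_comp _ f (fun x : R => c * x + d) x _ _ (hf _) ha)).
  by rewrite mulrC.
by apply: smooth_lin; exact: IH.
Qed.

End smooth_functions.

Section flat_function.
Context {R : realType}.

(** Bumps use only m = 0. The powers of 1/t make the family stable under differentiation up to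
    linear combinations, so smoothness is proved for all m at once. *)
Definition flat (m : nat) (t : R) : R :=
  if 0 < t then t^-1 ^+ m * expR (- t^-1) else 0.

Lemma flat_ge0 m t : 0 <= flat m t.
Proof.
by rewrite /flat; case: ifPn => // t0; rewrite mulr_ge0 ?expR_ge0// exprn_ge0// invr_ge0 ltW.
Qed.

(** Follows from exp y >= y^(m+1) / (m+1)! at y = 1/t; it controls the difference quotients at 0. *)
Lemma flat_le_linear m t : `|flat m t| <= m.+1`!%:R * `|t|.
Proof.
rewrite ger0_norm ?flat_ge0// /flat; case: ifPn => t0; last by rewrite mulr_ge0.
rewrite (gtr0_norm t0).
have i0 : 0 < t^-1 by rewrite invr_gt0.
have f0 : 0 < m.+1`!%:R :> R by rewrite ltr0n fact_gt0.
have := @expR_ge1Dxn _ t^-1 m (ltW i0) => h.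
have {}h : t^-1 ^+ m.+1 / m.+1`!%:R <= expR t^-1 by lra.
move: h; rewrite ler_pdivrMr// exprSr ler_pdivrMr// => h.
rewrite expRN ler_pdivrMr ?expR_gt0// (le_trans h)// le_eqVlt.
by apply/orP; left; apply/eqP; ring.
Qed.

Lemma is_derive_flat m (t : R) :
  is_derive t (1 : R) (flat m) (flat m.+2 t - m%:R * flat m.+1 t).
Proof.
have [t0|t0|t0] := ltgtP t 0.
- rewrite /flat ltNge (ltW t0)/= mulr0 subr0.
  apply: (@near_eq_is_derive _ _ _ (cst 0)).
  near=> x; rewrite ltNge [X in ~~ X](_ : _ = true)//; apply: ltW.
  by near: x; exact: lt_nbhsl.
- rewrite /flat t0/=.
  apply: (@near_eq_is_derive _ _ _ (fun t : R => t^-1 ^+ m * expR (- t^-1))).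
    near=> x; rewrite ifT//.
    by near: x; exact: lt_nbhsr.
  have tn0 : t != 0 by rewrite gt_eqF.
  have hi : is_derive t (1 : R) (fun t : R => t^-1) (- t^-1 ^+ 2).
    apply: DeriveDef; first exact: derivableV.
    rewrite (@deriveV _ _ id t)//= derive_id.
    by rewrite exprVn [_ *: _]mulr1.
  have hX : is_derive t (1 : R) (fun t : R => t^-1 ^+ m) (m%:R * t^-1 ^+ m.-1 * (- t^-1 ^+ 2)).
    rewrite (_ : (fun t : R => t^-1 ^+ m) = (fun t : R => t^-1) ^+ m).
      exact: (is_derive_eq (@is_deriveX _ _ _ m t 1 _ hi)).
    by apply/funext => y; rewrite fctE.
  have hE : is_derive t (1 : R) (fun t : R => expR (- t^-1)) (t^-1 ^+ 2 * expR (- t^-1)).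
    apply: (is_derive_eq (@is_derive1_comp _ expR (fun t : R => - t^-1) t _ _ (is_derive_expR _) (is_deriveN hi))).
    by rewrite opprK mulrC.
  apply: (is_derive_eq (is_deriveM hX hE)).
  transitivity (t^-1 ^+ m * (t^-1 ^+ 2 * expR (- t^-1)) +
    expR (- t^-1) * (m%:R * t^-1 ^+ m.-1 * - t^-1 ^+ 2)); first by [].
  by case: (m) => [|k] /=; rewrite ?exprS ?expr0 ?mul0r; ring.
- rewrite t0 /flat ltxx mulr0 subr0.
  suff h : h^-1 *: ((flat m \o shift 0) (h *: 1) - flat m 0) @[h --> (0 : R)^'] --> (0 : R).
    by apply: DeriveDef; [apply/cvg_ex; exists 0|exact/cvg_lim].
  apply: (@cvg_to_0_linear _ _ m.+2`!%:R 1) => // r /andP[r0 _].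
  rewrite /= addr0 [r *: 1]mulr1 [flat m 0]/flat ltxx subr0.
  apply: le_trans (flat_le_linear m.+1 r).
  rewrite (_ : r^-1 *: flat m r = flat m.+1 r)//.
  transitivity (r^-1 * flat m r); first by [].
  by rewrite /flat; case: ifPn => _; rewrite ?mulr0// exprS mulrA.
Unshelve. all: by end_near. Qed.

Lemma smooth_flat k m : smooth k (flat m).
Proof.
elim: k m => [m|k IH m]; first exact: is_derive_continuous (is_derive_flat m).
exists (fun t => 1 * flat m.+2 t + (- m%:R) * flat m.+1 t).
  by move=> t; apply: (is_derive_eq (is_derive_flat m t)); rewrite mul1r mulNr.
exact: smooth_lin.
Qed.

End flat_function.

(** * Bounds on first and second differences *)

Section tame.
Context {R : realType}.

(** The first bound handles large increments, the second makes moving averages Lipschitz, and the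
    third tames the kernel at 0. Keeping [nrm] abstract covers both the line and R^N with the
    Euclidean norm. *)
Definition tame (V : zmodType) (nrm : V -> R) (phi : V -> R) (M : R) : Prop :=
  [/\ forall z, `|phi z| <= M,
      forall z h, `|phi (z + h) - phi z| <= M * nrm h &
      forall z h, `|phi (z + h) + phi (z - h) - 2 * phi z| <= M * nrm h ^+ 2].

Section tame_mul.
Context (V : zmodType) (nrm : V -> R).
Hypothesis nrmN : forall h, nrm (- h) = nrm h.
Hypothesis nrm_ge0 : forall h, 0 <= nrm h.

Lemma tame_ge0 f M : tame nrm f M -> 0 <= M.
Proof. by case=> h _ _; exact: le_trans (h 0). Qed.

(** The second difference of a product splits into four terms, each at most Mf Mg |h|^2; hence the
    factor 4. *)
Lemma tame_mul f g Mf Mg : tame nrm f Mf -> tame nrm g Mg ->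
  tame nrm (fun z => f z * g z) (4 * Mf * Mg).
Proof.
move=> tf tg; have Mf0 := tame_ge0 tf; have Mg0 := tame_ge0 tg.
case: tf tg => [f0 f1 f2] [g0 g1 g2].
have MM : 0 <= Mf * Mg by exact: mulr_ge0.
split=> [z|z h|z h].
- rewrite normrM (@le_trans _ _ (Mf * Mg))//; first exact: ler_pM.
  by rewrite -mulrA; lra.
- have -> : f (z + h) * g (z + h) - f z * g z =
    f (z + h) * (g (z + h) - g z) + (f (z + h) - f z) * g z by ring.
  rewrite (le_trans (ler_normD _ _))// !normrM.
  apply: (@le_trans _ _ (Mf * (Mg * nrm h) + Mf * nrm h * Mg)).
    by apply: lerD; apply: ler_pM => //; exact: mulr_ge0.
  have := mulr_ge0 MM (nrm_ge0 h); set t := Mf * Mg * nrm h.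
  rewrite (_ : Mf * (Mg * nrm h) = t); last by rewrite /t; ring.
  rewrite (_ : Mf * nrm h * Mg = t); last by rewrite /t; ring.
  rewrite (_ : 4 * Mf * Mg * nrm h = 4 * t); last by rewrite /t; ring.
  lra.
- have -> : f (z + h) * g (z + h) + f (z - h) * g (z - h) - 2 * (f z * g z) =
    (f (z + h) + f (z - h) - 2 * f z) * g z +
    f z * (g (z + h) + g (z - h) - 2 * g z) +
    (f (z + h) - f z) * (g (z + h) - g z) +
    (f (z - h) - f z) * (g (z - h) - g z) by ring.
  have f1' := f1 z (- h); have g1' := g1 z (- h); rewrite nrmN in f1' g1'.
  have nh := nrm_ge0 h.
  have nh2 : 0 <= nrm h ^+ 2 by exact: sqr_ge0.
  pose t := Mf * Mg * nrm h ^+ 2.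
  rewrite (_ : 4 * Mf * Mg * nrm h ^+ 2 = t + t + t + t); last by rewrite /t; ring.
  have n4 (a b c d : R) : `|a + b + c + d| <= `|a| + `|b| + `|c| + `|d|.
    by do 2 rewrite (le_trans (ler_normD _ _)) ?lerD2r//; exact: ler_normD.
  apply: (le_trans (n4 _ _ _ _)); rewrite !normrM.
  apply: lerD; first apply: lerD; first apply: lerD.
  + rewrite (_ : t = Mf * nrm h ^+ 2 * Mg); last by rewrite /t; ring.
    exact: ler_pM.
  + rewrite (_ : t = Mf * (Mg * nrm h ^+ 2)); last by rewrite /t; ring.
    exact: ler_pM.
  + rewrite (_ : t = Mf * nrm h * (Mg * nrm h)); last by rewrite /t; ring.
    exact: ler_pM.
  + rewrite (_ : t = Mf * nrm h * (Mg * nrm h)); last by rewrite /t; ring.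
    exact: ler_pM.
Qed.

Lemma tame_prod (I : Type) (r : seq I) (f : I -> V -> R) :
  (forall i, exists M, tame nrm (f i) M) ->
  exists M, tame nrm (fun z => \prod_(i <- r) f i z) M.
Proof.
move=> tf; elim: r => [|i r [M tM]].
  exists 1; split=> [z|z h|z h]; rewrite !big_nil ?normr1//.
  - by rewrite subrr normr0 mul1r.
  - by rewrite (_ : 1 + 1 - 2 * 1 = 0 :> R) ?normr0 ?mul1r ?sqr_ge0//; ring.
have [Mi tMi] := tf i; exists (4 * Mi * M).
rewrite (_ : (fun z => _) = (fun z => f i z * \prod_(j <- r) f j z)).
  exact: tame_mul.
by apply/funext => z; rewrite big_cons.
Qed.

End tame_mul.

Lemma lipschitz_derive (f df : R -> R) (M x y : R) :
  (forall t, is_derive t (1 : R) f (df t)) -> (forall t, `|df t| <= M) ->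
  `|f y - f x| <= M * `|y - x|.
Proof.
move=> hf hM; wlog xy : x y / x <= y.
  move=> H; have [|/ltW yx] := leP x y; first exact: H.
  by rewrite distrC [`|y - x|]distrC; exact: H.
have cf : {within `[x, y], continuous f}.
  by apply: continuous_subspaceT; exact: is_derive_continuous hf.
have [c _ ->] := @MVT_segment R f df x y xy (fun t _ => hf t) cf.
by rewrite normrM ler_wpM2r.
Qed.

Lemma bounded_continuous_support (f : R -> R) (a b : R) : continuous f ->
  (forall t, t \notin `[a, b] -> f t = 0) -> exists M, forall t, `|f t| <= M.
Proof.
move=> cf f0; have [ab|ba] := leP a b; last first.
  exists 0 => // t; rewrite f0 ?normr0// in_itv/=.
  by apply/negP => /andP[at_ tb]; lra.
have [|c _ hc] := @EVT_max R (fun t => `|f t|) a b ab.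
  apply: continuous_subspaceT => t; apply: continuous_comp; first exact: cf.
  exact: norm_continuous.
exists `|f c| => t; have [tab|tab] := boolP (t \in `[a, b]); first exact: hc.
by rewrite f0// normr0.
Qed.

Lemma is_derive_support (f df : R -> R) (a b : R) :
  (forall t, is_derive t (1 : R) f (df t)) ->
  (forall t, t \notin `[a, b] -> f t = 0) -> forall t, t \notin `[a, b] -> df t = 0.
Proof.
move=> hf f0 t tab.
have h0 : is_derive t (1 : R) f 0.
  apply: (@near_eq_is_derive _ _ _ (cst 0)).
  move: tab; rewrite in_itv/= negb_and -!ltNge => /orP[ta|bt].
    near=> x; rewrite f0//= in_itv/= negb_and -!ltNge; apply/orP; left.
    by near: x; exact: lt_nbhsl.
  near=> x; rewrite f0//= in_itv/= negb_and -!ltNge; apply/orP; right.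
  by near: x; exact: lt_nbhsr.
by rewrite -(@derive_val _ _ _ _ _ _ _ (hf t)) derive_val.
Unshelve. all: by end_near. Qed.

Lemma tame_smooth_support (f : R -> R) (a b : R) : smooth 2 f ->
  (forall t, t \notin `[a, b] -> f t = 0) -> exists M, tame Num.norm f M.
Proof.
move=> [f1 d1 [f2 d2 c2]] f0.
have cf := is_derive_continuous d1; have c1 := is_derive_continuous d2.
have f10 := is_derive_support d1 f0; have f20 := is_derive_support d2 f10.
have [M0 h0] := bounded_continuous_support cf f0.
have [M1 h1] := bounded_continuous_support c1 f10.
have [M2 h2] := bounded_continuous_support c2 f20.
have N0 : 0 <= M0 by exact: le_trans (h0 0).
have N1 : 0 <= M1 by exact: le_trans (h1 0).
have N2 : 0 <= M2 by exact: le_trans (h2 0).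
have {}h0 t : `|f t| <= M0 + M1 + M2 by rewrite (le_trans (h0 _))//; lra.
have {}h1 t : `|f1 t| <= M0 + M1 + M2 by rewrite (le_trans (h1 _))//; lra.
have {}h2 t : `|f2 t| <= M0 + M1 + M2 by rewrite (le_trans (h2 _))//; lra.
exists (M0 + M1 + M2); split=> [//|z h|z h].
  by have := @lipschitz_derive f f1 _ z (z + h) d1 h1; rewrite (addrC z) addrK.
(* The second difference is the increment of t -> f(t + h) - f(t) from z - h to z; the derivative of
   this function is at most M |h|. *)
have dD t : is_derive t (1 : R) (fun t => f (t + h) - f t) (f1 (t + h) - f1 t).
  have sh : is_derive t (1 : R) (fun t : R => t + h) 1.
    have H := is_deriveD (is_derive_id t (1 : R)) (is_derive_cst h t (1 : R)).
    by apply: (is_derive_eq H); rewrite addr0.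
  have := is_deriveB (@is_derive1_comp _ f (fun t : R => t + h) t _ _ (d1 _) sh) (d1 t).
  by rewrite mulr1.
have := @lipschitz_derive _ _ ((M0 + M1 + M2) * `|h|) (z - h) z dD.
rewrite subrK (_ : f (z + h) - f z - (f z - f (z - h)) =
  f (z + h) + f (z - h) - 2 * f z); last by ring.
rewrite (_ : z - (z - h) = h); last by ring.
rewrite expr2 mulrA; apply => t.
by have := @lipschitz_derive f1 f2 _ t (t + h) d2 h2; rewrite (addrC t) addrK.
Qed.

End tame.

(** * Products of one-variable functions *)

Section product_functions.
Context {R : realType} (N : nat).
Implicit Types g : 'I_N -> R -> R.

Definition row_prod g (v : 'rV[R]_N) : R := \prod_(i < N) g i (v ord0 i).

Lemma continuous_row_prod g : (forall i, continuous (g i)) -> continuous (row_prod g).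
Proof.
move=> cg; apply: (@continuous_big R 'I_N *%R 1 xpredT (@mul_continuous R)
  'rV[R]_N (index_enum 'I_N) (fun i v => g i (v ord0 i))).
by move=> i _ x; apply: continuous_comp; [exact: coord_continuous | exact: cg].
Qed.

Lemma measurable_row_prod g : (forall i, continuous (g i)) ->
  measurable_fun [set: 'rV[R]_N] (row_prod g).
Proof.
move=> cg; apply: measurable_prod => i _.
apply: (@measurableT_comp _ _ _ _ (measurableTypeR R) _ (g i)).
  exact: continuous_measurable_fun.
exact: measurable_row_coord.
Qed.

Lemma is_derive_row_prod g dg i (x : 'rV[R]_N) : is_derive (x ord0 i) (1 : R) (g i) dg ->
  is_derive x (delta_mx ord0 i) (row_prod g)
    (dg * \prod_(j < N | j != i) g j (x ord0 j)).
Proof.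
move=> [hd <-]; set P := \prod_(j < N | _) _.
suff h : h^-1 *: ((row_prod g \o shift x) (h *: delta_mx ord0 i) - row_prod g x)
    @[h --> (0 : R)^'] --> 'D_1 (g i) (x ord0 i) * P.
  by apply: DeriveDef; [apply/cvg_ex; eexists; exact: h | exact/cvg_lim].
(* Only the factor with index i moves, so the quotient is a one-variable quotient times the constant
   [P]. *)
rewrite (_ : (fun h : R => _) = (fun h : R =>
  h^-1 *: ((g i \o shift (x ord0 i)) (h *: 1) - g i (x ord0 i)) * P)).
  by apply: cvgMr_tmp; exact: hd.
apply/funext => h; rewrite /row_prod /= (bigD1 i)//= [X in _ - X](bigD1 i)//=.
rewrite !mxE eqxx/= (eq_bigr (fun j => g j (x ord0 j))) => [|j ji].
  by rewrite eqxx -/P -mulrBl -scalerAl.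
by rewrite !mxE (negPf ji) andbF mulr0 add0r.
Qed.

Lemma smooth_derive (f : R -> R) : (forall k, smooth k f) ->
  (forall x, derivable f x (1 : R)) /\ forall k, smooth k (fun x => 'D_1 f x).
Proof.
move=> sf; split => [x|k]; first by have [df h _] := sf 1%N; exact: ex_derive.
have [df h sdf] := sf k.+1; rewrite (_ : (fun x => _) = df)//.
by apply/funext => x; rewrite derive_val.
Qed.

(** A partial derivative replaces one factor by its derivative and is again such a product, so the
    induction must range over all [g]. *)
Lemma Ck_row_prod g k : (forall i j, smooth j (g i)) -> Ck k (row_prod g).
Proof.
elim: k g => [|k IH] g sg.
  by split => //; apply: continuous_row_prod => i; exact: (smooth_continuous (sg i 0%N)).
split; first by apply: continuous_row_prod => i; exact: (smooth_continuous (sg i 0%N)).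
move=> i; have [di si] := smooth_derive (sg i).
have hd (x : 'rV[R]_N) := is_derive_row_prod (derivableP (di (x ord0 i))).
split=> [x|]; first exact: ex_derive.
rewrite (_ : (fun x => _) =
    row_prod (fun j => if j == i then (fun t => 'D_1 (g i) t) else g j)).
  by apply: IH => j l; case: eqP => // _; exact: si.
apply/funext => x; rewrite (@derive_val _ _ _ _ _ _ _ (hd x)) /row_prod.
rewrite [RHS](bigD1 i)//= eqxx; congr (_ * _).
by apply: eq_bigr => j /negPf ->.
Qed.

Lemma tame_row_prod g : (forall i, exists M, tame Num.norm (g i) M) ->
  exists M, tame (@enorm R N) (row_prod g) M.
Proof.
move=> tg; apply: tame_prod.
- exact: enormN.
- exact: enorm_ge0.
move=> i; have [M tM] := tg i; exists M; have M0 := tame_ge0 tM.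
case: tM => h0 h1 h2; split => [z|z h|z h]; rewrite ?mxE//.
- by rewrite (le_trans (h1 _ _))// ler_wpM2l// coord_le_enorm.
- rewrite (le_trans (h2 _ _))// ler_wpM2l//.
  by rewrite lerXn2r ?nnegrE ?enorm_ge0// coord_le_enorm.
Qed.

Lemma test_function_row_prod g (a b : 'rV[R]_N) : (forall i j, smooth j (g i)) ->
  (forall i t, t \notin `[a ord0 i, b ord0 i] -> g i t = 0) ->
  test_function (row_prod g).
Proof.
move=> sg g0; split; first by move=> k; exact: Ck_row_prod.
pose K := [set v : 'rV[R]_N | forall i, `[a ord0 i, b ord0 i]%classic (v ord0 i)].
have cK : compact K.
  apply: (@rV_compact R N (fun i => `[a ord0 i, b ord0 i]%classic)) => i.
  exact: segment_compact.
apply: (subclosed_compact _ cK); first exact: closed_closure.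
rewrite [X in _ `<=` X](_ : K = closure K); last first.
  apply/closure_id; apply: compact_closed => //; exact: norm_hausdorff.
apply: closureS => v /= v0 i.
apply/negPn/negP => vi; move: v0; rewrite /row_prod (bigD1 i)//= g0 ?mul0r ?eqxx//.
Qed.

End product_functions.

(** * Bumps on boxes and approximation of indicators *)

Section bumps.
Context {R : realType}.

Lemma flat0_le1 (t : R) : flat 0 t <= 1.
Proof.
rewrite /flat expr0 mul1r; case: ifPn => // t0.
by rewrite expR_le1 oppr_le0 invr_ge0 ltW.
Qed.

(** One factor switches on at a, the other off at b; [c] is the steepness. The arguments have the
    affine form of [smooth_affine]. *)
Definition bump1 (c a b t : R) : R :=
  flat 0 (c * t + - (c * a)) * flat 0 (- c * t + c * b).

Lemma bump1_ge0 c a b t : 0 <= bump1 c a b t.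
Proof. by rewrite mulr_ge0// flat_ge0. Qed.

Lemma bump1_le1 c a b t : bump1 c a b t <= 1.
Proof. by rewrite mulr_ile1// ?flat_ge0 ?flat0_le1. Qed.

Lemma smooth_bump1 c a b k : smooth k (bump1 c a b).
Proof. by apply: smooth_mul; apply: smooth_affine; exact: smooth_flat. Qed.

Lemma bump1_out c a b t : 0 < c -> t \notin `]a, b[ -> bump1 c a b t = 0.
Proof.
move=> c0; rewrite in_itv/= negb_and -!leNgt => /orP[ta|bt]; rewrite /bump1.
  rewrite [X in X * _]/flat ifF ?mul0r//; apply/negbTE.
  by rewrite -leNgt subr_le0 ler_pM2l.
rewrite [X in _ * X]/flat ifF ?mulr0//; apply/negbTE.
by rewrite -leNgt mulNr addrC subr_le0 ler_pM2l.
Qed.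

Lemma bump1_shift c a b x t : bump1 c a b (t - x) = bump1 c (a + x) (b + x) t.
Proof. by rewrite /bump1; congr (flat 0 _ * flat 0 _); ring. Qed.

Context (N : nat).
Implicit Types (a b x v : 'rV[R]_N) (c : R).

Definition bump c a b : 'rV[R]_N -> R :=
  row_prod (fun i => bump1 c (a ord0 i) (b ord0 i)).

Lemma bump_ge0 c a b v : 0 <= bump c a b v.
Proof. by apply: prodr_ge0 => i _; exact: bump1_ge0. Qed.

Lemma bump_le1 c a b v : bump c a b v <= 1.
Proof. by rewrite /bump /row_prod prodr_ile1// => i _; rewrite bump1_ge0 bump1_le1. Qed.

Lemma bump_out c a b v : 0 < c -> ~ ocbox a b v -> bump c a b v = 0.
Proof.
move=> c0 /existsNP[i vi]; rewrite /bump /row_prod (bigD1 i)//= bump1_out ?mul0r//.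
by apply/negP => h; apply: vi; exact: subset_itv_oo_oc h.
Qed.

Lemma bump_shift c a b x v : bump c a b (v - x) = bump c (a + x) (b + x) v.
Proof. by apply: eq_bigr => i _; rewrite !mxE bump1_shift. Qed.

Lemma measurable_bump c a b : measurable_fun [set: 'rV[R]_N] (bump c a b).
Proof.
by apply: measurable_row_prod => i; exact: smooth_continuous (smooth_bump1 _ _ _ 0).
Qed.

Lemma test_function_bump c a b : 0 < c -> test_function (bump c a b).
Proof.
move=> c0; apply: (@test_function_row_prod _ _ _ a b) => [i j|i t tab].
  exact: smooth_bump1.
by apply: bump1_out => //; apply: contra tab; exact: subset_itv_oo_cc.
Qed.

Lemma tame_bump c a b : 0 < c -> exists M, tame (@enorm R N) (bump c a b) M.
Proof.
move=> c0; apply: tame_row_prod => i.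
apply: (@tame_smooth_support _ _ (a ord0 i) (b ord0 i)); first exact: smooth_bump1.
by move=> t tab; apply: bump1_out => //; apply: contra tab; exact: subset_itv_oo_cc.
Qed.

(* The outer endpoint b + 1/(n+1) decreases to b slower than the speed (n+1)^2
   grows, so that the limit is 1 also at the right endpoint. *)
Definition bump_approx a b (n : nat) : 'rV[R]_N -> R :=
  bump (n.+1%:R ^+ 2) a (b + const_mx n.+1%:R^-1).

Lemma flat0_cvg (u : nat -> R) (e : R) : 0 < e ->
  (forall n, e * n.+1%:R <= u n) -> flat 0 (u n) @[n --> \oo] --> (1 : R).
Proof.
move=> e0 ue.
have u0 n : 0 < u n by rewrite (lt_le_trans _ (ue n))// mulr_gt0.
rewrite (_ : (fun n => _) = fun n => expR (- (u n)^-1)); last first.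
  by apply/funext => n; rewrite /flat u0 expr0 mul1r.
rewrite -expR0; apply: continuous_cvg; first exact: continuous_expR.
rewrite -[X in _ --> X]oppr0; apply: cvgN.
have hz : e^-1 * n.+1%:R^-1 @[n --> \oo] --> (0 : R).
  by rewrite -[X in _ --> X](mulr0 e^-1); apply: cvgMl_tmp; exact: cvg_harmonic.
apply: squeeze_cvgr (@cvg_cst _ _ _ _ _) hz.
near=> n; rewrite invr_ge0 (ltW (u0 n))/= -invfM lef_pV2 ?posrE ?mulr_gt0//.
Unshelve. all: by end_near. Qed.

Lemma bump1_approx_cvg (a b t : R) : a < t <= b ->
  bump1 (n.+1%:R ^+ 2) a (b + n.+1%:R^-1) t @[n --> \oo] --> (1 : R).
Proof.
move=> /andP[at_ tb]; rewrite -[X in _ --> X](mulr1 1); apply: cvgM.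
  apply: (@flat0_cvg _ (t - a)); first by rewrite subr_gt0.
  move=> n; rewrite -mulrBr mulrC ler_wpM2r ?subr_ge0 ?(ltW at_)//.
  by rewrite expr2 ler_peMr// ler1n.
apply: (@flat0_cvg _ 1) => // n.
have n0 : 0 < n.+1%:R :> R by [].
rewrite mulNr addrC -mulrBr addrAC mulrDr expr2 mul1r.
rewrite [X in _ + X](_ : _ = n.+1%:R); last first.
  by rewrite mulfK// gt_eqF.
by rewrite lerDr mulr_ge0 ?mulr_ge0 ?subr_ge0.
Qed.

Lemma bump_approx_cvg a b v :
  bump_approx a b n v @[n --> \oo] --> (\1_(ocbox a b) v : R).
Proof.
have [vab|vab] := pselect (ocbox a b v).
  rewrite indicE mem_set//.
  rewrite -[X in _ --> X](_ : \prod_(i < N) 1 = 1 :> R); last by rewrite big1.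
  apply: (@cvg_big R 'I_N *%R 1 xpredT (@mul_continuous R) _ _ (index_enum 'I_N)
    (fun i n => bump1 (n.+1%:R ^+ 2) (a ord0 i) ((b + const_mx n.+1%:R^-1) ord0 i) (v ord0 i))
    (fun=> 1)) => i _.
  under eq_fun do rewrite !mxE.
  by apply: bump1_approx_cvg; have := vab i; rewrite /= in_itv.
rewrite indicE memNset//.
suff h : \forall n \near \oo, 0 = bump_approx a b n v.
  apply: cvg_trans (@cvg_cst R 0 _ \oo _).
  exact: near_eq_cvg h.
have /existsNP[i vi] := vab.
move: vi => /negP; rewrite in_itv/= negb_and -leNgt -ltNge => /orP[va|bv].
  near=> n; rewrite /bump_approx bump_out ?exprn_gt0// => /(_ i).
  by rewrite /= in_itv/= ltNge va.
(* Beyond b_i the bump vanishes only once 1/(n+1) is less than v_i - b_i. *)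
have h0 : (@harmonic R) n @[n --> \oo] --> (0 : R) by exact: cvg_harmonic.
near=> n; rewrite /bump_approx bump_out ?exprn_gt0// => /(_ i).
rewrite /= in_itv/= !mxE => /andP[_]; apply/negP; rewrite -ltNge -ltrBrDl.
by near: n; apply: (cvgr_lt _ h0); rewrite subr_gt0.
Unshelve. all: by end_near. Qed.

Lemma bump_approx_le a b n v :
  bump_approx a b n v <= \1_(ocbox a (b + const_mx 1)) v.
Proof.
have [vab|vab] := pselect (ocbox a (b + const_mx 1) v).
  by rewrite indicE mem_set// bump_le1.
rewrite indicE memNset// /bump_approx bump_out ?exprn_gt0// => h; apply: vab => i.
have := h i; rewrite /= !in_itv/= !mxE => /andP[-> /le_trans]; apply.
by rewrite lerD2l invf_le1// ler1n.
Qed.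

End bumps.

(** * The fractional Laplacian as an absolutely convergent integral *)

Section fraclap_formula.
Context {R : realType} (N : nat).
Variables (s : R) (hs : 0 < s < 1).
Local Notation mu := (lebesgue_row N).
Local Notation e := (N%:R + 2 * s).

(* Averaging the increments at h and -h makes the principal value absolutely
   convergent: sdq is dominated by riesz e (enorm h). *)
Definition sdq (phi : 'rV[R]_N -> R) (z h : 'rV[R]_N) : R :=
  (phi (z + h) + phi (z - h) - 2 * phi z) / (2 * enorm h `^ e).

(** Away from the origin even first difference quotients are dominated by the integrable kernel, so
    truncated integrals can be split and averaged. *)
Lemma riesz_kernel_le (eps r : R) : 0 < eps -> eps < r ->
  (r `^ e)^-1 <= (Num.min 1 (eps ^+ 2))^-1 * riesz e r.
Proof.
move=> eps0 er; rewrite /riesz mulrA ler_peMl ?invr_ge0 ?powR_ge0//.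
rewrite mulrC ler_pdivlMr ?lt_min ?ltr01 ?exprn_gt0// mul1r.
rewrite le_min ge_min lexx/= ge_min; apply/orP; right.
by rewrite lerXn2r ?nnegrE ?ltW// (lt_trans eps0).
Qed.

Variables (phi : 'rV[R]_N -> R) (M : R).
Hypotheses (mphi : measurable_fun [set: _] phi) (tphi : tame (@enorm R N) phi M).

Let M0 : 0 <= M. Proof. exact: tame_ge0 tphi. Qed.

Lemma second_difference_le z h :
  `|phi (z + h) + phi (z - h) - 2 * phi z| <= 4 * M * Num.min 1 (enorm h ^+ 2).
Proof.
have [f0 _ f2] := tphi; case: (leP 1 (enorm h ^+ 2)) => _; last first.
  rewrite (le_trans (f2 _ _))// ler_wpM2r ?sqr_ge0//; have := M0; lra.
have := f0 z; have := f0 (z - h); have := f0 (z + h).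
rewrite mulr1 !ler_norml => /andP[? ?] /andP[? ?] /andP[? ?].
by apply/andP; split; lra.
Qed.

Lemma sdq_le z h : `|sdq phi z h| <= 2 * M * riesz e (enorm h).
Proof.
rewrite /sdq /riesz normrM mulrA normfV (ger0_norm (mulr_ge0 _ (powR_ge0 _ _)))//.
rewrite invfM mulrA ler_wpM2r ?invr_ge0 ?powR_ge0//.
by rewrite ler_pdivrMr// (le_trans (second_difference_le _ _))//; lra.
Qed.

Lemma measurable_translate (z : 'rV[R]_N) (c : R) :
  measurable_fun [set: 'rV[R]_N] (fun h => phi (z + c *: h)).
Proof. exact: (measurableT_comp mphi (measurable_sign_affine z c)). Qed.

Lemma measurable_enormV : measurable_fun [set: 'rV[R]_N] (fun h => (enorm h `^ e)^-1).
Proof.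
under eq_fun do rewrite -powRN.
apply: (@measurableT_comp _ _ _ _ _ _ (fun r : R => r `^ (- e)) _ (@enorm R N)).
  exact: measurable_powR.
exact: measurable_enorm.
Qed.

Lemma measurable_sdq z : measurable_fun [set: 'rV[R]_N] (sdq phi z).
Proof.
have m1 := measurable_translate z 1; have m2 := measurable_translate z (-1).
rewrite (_ : sdq phi z = fun h => 2^-1 *
    (phi (z + 1 *: h) + phi (z + (-1) *: h) - 2 * phi z) * (enorm h `^ e)^-1); last first.
  apply/funext => h; rewrite scale1r scaleN1r /sdq invfM; ring.
apply: measurable_funM; last exact: measurable_enormV.
by apply: measurable_funM => //; apply: measurable_funB => //; exact: measurable_funD.
Qed.

Lemma integrable_sdq z : mu.-integrable [set: _] (EFin \o sdq phi z).
Proof.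
apply: (@le_integrable_real _ _ R mu _ _ (fun h => 2 * M * riesz e (enorm h))) => //.
- exact: measurable_sdq.
- by move=> h _; exact: sdq_le.
rewrite (_ : _ \o _ = fun h => ((2 * M)%:E * (riesz e (enorm h))%:E)%E)//.
by apply: integrableZl => //; exact: integrable_riesz_enorm.
Qed.

Let D (eps : R) := [set h : 'rV[R]_N | eps < enorm h].

Let mD eps : measurable (D eps).
Proof.
rewrite (_ : D eps = ~` [set h | enorm h <= eps]).
  apply: measurableC; rewrite -[X in measurable X]setTI.
  by apply: measurable_fun_le => //; exact: measurable_enorm.
by apply/seteqP; split => h; rewrite /D /= ltNge => /negP.
Qed.

Let G (c : R) z h := (phi (z + c *: h) - phi z) / enorm h `^ e.

Let integrable_G (c eps : R) z : 0 < eps ->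
  mu.-integrable (D eps) (EFin \o G c z).
Proof.
move=> eps0; pose K := 2 * M * (Num.min 1 (eps ^+ 2))^-1.
apply: (@le_integrable_real _ _ R mu _ _ (fun h => K * riesz e (enorm h))) => //.
- apply: measurable_funTS; apply: measurable_funM; last exact: measurable_enormV.
  by apply: measurable_funB => //; exact: measurable_translate.
- move=> h Dh; rewrite /G normrM /K -mulrA ler_pM//.
    have [f0 _ _] := tphi; have := f0 z; have := f0 (z + c *: h).
    by rewrite !ler_norml => /andP[? ?] /andP[? ?]; apply/andP; split; lra.
  by rewrite ger0_norm ?invr_ge0 ?powR_ge0//; exact: riesz_kernel_le.
rewrite (_ : _ \o _ = fun h => (K%:E * (riesz e (enorm h))%:E)%E)//.
apply: integrableZl => //.
exact: (integrableS measurableT (mD eps) (@subsetT _ _) (integrable_riesz_enorm N hs)).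
Qed.

(** Substitution y = z + c h, where c = 1 or c = -1 preserves the truncation and the kernel. *)
Let truncated_integral (c eps : R) z : c ^+ 2 = 1 ->
  \int[mu]_(y in [set y | eps < enorm (z - y)])
     ((phi y - phi z) / enorm (y - z) `^ e) = \int[mu]_(h in D eps) G c z h.
Proof.
move=> c1; have encZ h : enorm (c *: h) = enorm h.
  by move/eqP: c1; rewrite sqrf_eq1 => /orP[]/eqP ->; rewrite ?scale1r// scaleN1r enormN.
have mT := measurable_sign_affine z (-1).
have mA : measurable [set y | eps < enorm (z - y)].
  rewrite (_ : [set y | _] = (fun y => z + (-1) *: y) @^-1` D eps).
    by rewrite -[X in measurable X]setTI; exact: mT.
  by apply/seteqP; split => y; rewrite /D /= scaleN1r.
have mf : measurable_fun [set: 'rV[R]_N]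
    (fun y => (phi y - phi z) / enorm (y - z) `^ e).
  apply: measurable_funM; first exact: measurable_funB.
  have := measurableT_comp measurable_enormV (measurable_sign_affine (- z) 1).
  by apply: eq_measurable_fun => y _ /=; rewrite scale1r addrC.
rewrite /Rintegral; apply: (f_equal fine).
have /(@integral_sign_affine R N z c _ _ c1 mA) H : measurable_fun [set: 'rV[R]_N]
    (EFin \o (fun y => (phi y - phi z) / enorm (y - z) `^ e)).
  exact/measurable_EFinP.
apply: (eq_trans H).
rewrite (_ : _ @^-1` _ = D eps).
  by apply: eq_integral => h _; rewrite /= /G [_ - z]addrAC subrr add0r encZ.
by apply/seteqP; split => h; rewrite /D /= opprD addrA subrr add0r enormN encZ.
Qed.

Lemma truncated_sdq eps z : 0 < eps ->
  \int[mu]_(y in [set y | eps < enorm (z - y)])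
     ((phi y - phi z) / enorm (y - z) `^ e) = \int[mu]_(h in D eps) sdq phi z h.
Proof.
move=> eps0; have [c1 c2] : (1 : R) ^+ 2 = 1 /\ (- 1 : R) ^+ 2 = 1 by rewrite sqrrN !expr1n.
have h1 := truncated_integral eps z c1; have h2 := truncated_integral eps z c2.
set I := \int[mu]_(y in _) _ in h1 h2 *.
(* One copy is rewritten with h and the other with -h. *)
have -> : I = 2^-1 * (I + I) by field.
have i1 := integrable_G 1 z eps0; have i2 := integrable_G (-1) z eps0.
have i12 : mu.-integrable (D eps) (EFin \o (fun h => G 1 z h + G (-1) z h)).
  exact: (integrableD (mD eps) i1 i2).
have hD := RintegralD (mD eps) i1 i2.
have hZ := RintegralZl 2^-1 (mD eps) i12.
rewrite {1}h1 h2.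
apply: (eq_trans _ (eq_trans (esym hZ) _)); first by rewrite hD.
apply: eq_Rintegral => h _; rewrite /G /sdq scale1r scaleN1r invfM; ring.
Qed.

Lemma fraclapE z : fraclap s phi z =
  - (fraclap_const N s * \int[mu]_h sdq phi z h).
Proof.
rewrite /fraclap; congr (- (_ * _)); apply/cvg_lim => //.
apply/cvg_at_rightP => eps [eps0 eps_cvg].
under eq_fun do rewrite truncated_sdq//.
rewrite /Rintegral; apply: fine_cvg.
rewrite fineK; last exact: integrable_fin_num (integrable_sdq z).
under eq_fun do rewrite integral_mkcond.
pose f n := (fun h => (sdq phi z h)%:E) \_ (D (eps n)).
have [] // := @dominated_convergence _ _ R mu [set: _] measurableT
  f (EFin \o sdq phi z) (fun h => (2 * M * riesz e (enorm h))%:E).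
- move=> n; apply/(measurable_restrictT _ (mD _)).
  by apply: measurable_funTS; apply/measurable_EFinP; exact: measurable_sdq.
- by apply/measurable_EFinP; exact: measurable_sdq.
(* The origin lies in no truncated domain, so the limit there is 0; it agrees with [sdq], whose
   quotient by 0 is 0. Any other h is in the domain as soon as eps n < |h|. *)
- apply: aeW => h _; have [h0|h0] := eqVneq (enorm h) 0.
    have s0 : sdq phi z h = 0.
      by rewrite /sdq h0 powR0 ?mulr0 ?invr0 ?mulr0// gt_eqF// ltr_wpDl//; case/andP: hs; lra.
    rewrite (_ : (fun n => f n h) = cst 0%E) /= ?s0; first exact: cvg_cst.
    by apply/funext => n; rewrite /f /patch s0; case: ifP.
  apply: (cvg_trans (@near_eq_cvg _ _ _ _ (cst (sdq phi z h)%:E) _ _)); last exact: cvg_cst.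
  have hp : 0 < enorm h by rewrite lt_def h0 enorm_ge0.
  near=> n; rewrite /f /patch mem_set// /D /=.
  by near: n; exact: (cvgr_lt _ eps_cvg).
- rewrite (_ : (fun h => _) = fun h => ((2 * M)%:E * (riesz e (enorm h))%:E)%E)//.
  by apply: integrableZl => //; exact: integrable_riesz_enorm.
- apply: aeW => h n _; rewrite /f /patch; case: ifP => _; rewrite ?abse_EFin lee_fin.
    exact: sdq_le.
  by rewrite normr0 (mulr_ge0 _ (riesz_ge0 _ _))// mulr_ge0.
Unshelve. all: by end_near. Qed.

End fraclap_formula.

(** * Moving averages *)

Section Lp_local.
Context d (T : measurableType d) (R : realType) (mu : {measure set T -> \bar R}).
Variables (p : R) (u : T -> R).
Hypotheses (p1 : 1 <= p) (mu_u : measurable_fun [set: T] u).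
Hypothesis iu : mu.-integrable [set: T] (fun x => (`|u x| `^ p)%:E).

(** If |t| > delta, then |t| = |t|^(1-p) |t|^p with 1 - p <= 0. This takes the place of the Hölder
    inequality and treats p = 1 uniformly. *)
Lemma norm_le_powR (delta t : R) : 0 < delta ->
  `|t| <= delta + delta `^ (1 - p) * `|t| `^ p.
Proof.
move=> d0; have [td|td] := leP `|t| delta.
  by rewrite ler_wpDr// mulr_ge0 ?powR_ge0.
apply: (@le_trans _ _ (delta `^ (1 - p) * `|t| `^ p)); last by rewrite ler_wpDl// ltW.
have t0 : 0 < `|t| by exact: lt_trans td.
rewrite -[leLHS]mul1r -(@ler_pdivrMr _ (`|t| `^ p)) ?powR_gt0//.
rewrite [leLHS](_ : _ = `|t| `^ (1 - p)); last first.
  rewrite powRB ?powRr1 ?mul1r ?normr_ge0//.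
  by rewrite (gt_eqF t0) implybT.
rewrite -[1 - p]opprB !powRN lef_pV2 ?posrE ?powR_gt0//.
by rewrite ge0_ler_powR ?nnegrE ?subr_ge0// ltW.
Qed.

Lemma integral_norm_le_powR (A : set T) (delta : R) : measurable A -> 0 < delta ->
  (\int[mu]_(y in A) `|u y|%:E <=
    delta%:E * mu A + (delta `^ (1 - p))%:E * \int[mu]_(y in A) (`|u y| `^ p)%:E)%E.
Proof.
move=> mA d0; have m1 : measurable_fun A (fun y => (`|u y| `^ p)%:E).
  exact: measurable_funTS (measurable_int _ iu).
have -> : (delta%:E * mu A)%E = (\int[mu]_(y in A) (cst delta%:E y))%E.
  by rewrite integral_cst.
rewrite -ge0_integralZl_EFin ?powR_ge0//.
rewrite -ge0_integralD//; last 3 first.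
- by move=> y _; rewrite lee_fin ltW.
- by move=> y _; rewrite mule_ge0// lee_fin powR_ge0.
- by apply: emeasurable_funM.
apply: ge0_le_integral => //.
- apply/measurable_EFinP; apply: measurableT_comp => //; exact: measurable_funTS.
- by apply: emeasurable_funD => //; apply: emeasurable_funM.
- by move=> y _; rewrite -EFinM -EFinD lee_fin norm_le_powR.
Qed.

(** The case delta = 1, with L the integral of |u|^p; the bound sees A only through its measure. *)
Lemma integral_norm_uniform : exists2 L : R, 0 <= L &
  forall A, measurable A -> (\int[mu]_(y in A) `|u y|%:E <= mu A + L%:E)%E.
Proof.
have Ifin := integrable_fin_num measurableT iu.
exists (fine (\int[mu]_y (`|u y| `^ p)%:E)).
  by apply: fine_ge0; apply: integral_ge0 => y _; rewrite lee_fin powR_ge0.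
move=> A mA; apply: (le_trans (integral_norm_le_powR mA ltr01)).
rewrite powR1 !mul1e leeD2l// fineK//; apply: ge0_subset_integral => //.
exact: measurable_int iu.
Qed.

End Lp_local.

(** Three sets, because phi(y + h), phi(y - h) and phi(y) live on three translates of one box. *)
Lemma le_three_indic (T : Type) (R : realDomainType) (A1 A2 A3 : set T)
    (psi : T -> R) (K : R) : 0 <= K -> (forall y, `|psi y| <= K) ->
  (forall y, ~ A1 y -> ~ A2 y -> ~ A3 y -> psi y = 0) ->
  forall y, `|psi y| <= K * (\1_A1 y + \1_A2 y + \1_A3 y).
Proof.
move=> K0 psiK psi0 y; rewrite !indicE -!natrD.
have [h|h] := pselect [\/ A1 y, A2 y | A3 y]; last first.
  by rewrite psi0 ?normr0 ?mulr_ge0// => ?; apply: h; [apply: Or31|apply: Or32|apply: Or33].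
rewrite (le_trans (psiK y))// ler_peMr// ler1n.
by case: h => /mem_set ->; rewrite ?addn1 ?addnS.
Qed.

Section bump_average.
Context {R : realType} (N : nat).
Local Notation mu := (lebesgue_row N).
Variables (u : 'rV[R]_N -> R) (L : R).
Hypotheses (mu_u : measurable_fun [set: 'rV[R]_N] u) (L0 : 0 <= L).
Hypothesis uL : forall A, measurable A ->
  (\int[mu]_(y in A) `|u y|%:E <= mu A + L%:E)%E.

Lemma lebesgue_row_ocbox_shift (a b x : 'rV[R]_N) :
  mu (ocbox (a + x) (b + x)) = mu (ocbox a b).
Proof.
rewrite !lebesgue_row_ocbox; apply: eq_bigr => i _.
rewrite !lebesgue_measure_itv/= !mxE !lte_fin ltrD2r; case: ifP => // _.
by rewrite -!EFinB; congr EFin; ring.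
Qed.

(** Bounds the integral of |u| over every translate of the box. *)
Definition box_mass (a b : 'rV[R]_N) : R := fine (mu (ocbox a b)) + L.

Lemma box_mass_ge0 a b : 0 <= box_mass a b.
Proof. by rewrite addr_ge0// fine_ge0. Qed.

Lemma integral_norm_box (a b x : 'rV[R]_N) :
  (\int[mu]_(y in ocbox (a + x) (b + x)) `|u y|%:E <= (box_mass a b)%:E)%E.
Proof.
apply: (le_trans (uL (measurable_ocbox _ _))).
rewrite lebesgue_row_ocbox_shift /box_mass EFinD fineK// ge0_fin_numE//.
exact: lebesgue_row_ocbox_lty.
Qed.

Lemma integrable_box (a b : 'rV[R]_N) : mu.-integrable (ocbox a b) (EFin \o u).
Proof.
apply/integrableP; split; first exact/measurable_EFinP/measurable_funTS.
by have := integral_norm_box a b 0; rewrite !addr0 => /le_lt_trans; apply; exact: ltry.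
Qed.

Lemma integral_norm_box_indic (a b x : 'rV[R]_N) :
  (\int[mu]_y (`|u y| * \1_(ocbox (a + x) (b + x)) y)%:E <= (box_mass a b)%:E)%E.
Proof.
apply: le_trans (integral_norm_box a b x).
rewrite [leRHS]integral_mkcond le_eqVlt; apply/orP; left; apply/eqP.
by apply: eq_integral => y _; rewrite /patch indicE;
  case: (y \in _); rewrite ?mulr1 ?mulr0.
Qed.

Lemma integral_norm_three (a b x1 x2 x3 : 'rV[R]_N) (psi : 'rV[R]_N -> R) (K : R) :
  0 <= K -> measurable_fun [set: _] psi ->
  (forall y, `|psi y| <= K * (\1_(ocbox (a + x1) (b + x1)) y +
     \1_(ocbox (a + x2) (b + x2)) y + \1_(ocbox (a + x3) (b + x3)) y)) ->
  (\int[mu]_y `|u y * psi y|%:E <= (K * (3 * box_mass a b))%:E)%E.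
Proof.
move=> K0 mpsi hpsi; pose g x y : R := `|u y| * \1_(ocbox (a + x) (b + x)) y.
have g0 x y : 0 <= g x y by rewrite mulr_ge0.
have mg x : measurable_fun [set: 'rV[R]_N] (fun y => (g x y)%:E).
  apply/measurable_EFinP; apply: measurable_funM; first exact: measurableT_comp.
  by apply: measurable_indic; exact: measurable_ocbox.
have mK x : measurable_fun [set: 'rV[R]_N] (fun y => (K%:E * (g x y)%:E)%E).
  exact: emeasurable_funM.
have Kg0 x y : (0 <= K%:E * (g x y)%:E)%E by rewrite mule_ge0// lee_fin.
apply: (@le_trans _ _ (\int[mu]_y (K%:E * (g x1 y)%:E + K%:E * (g x2 y)%:E + K%:E * (g x3 y)%:E)%E)%E).
  apply: ge0_le_integral => //.
  - apply/measurable_EFinP; apply: measurableT_comp => //; exact: measurable_funM.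
  - by apply: emeasurable_funD => //; exact: emeasurable_funD.
  - move=> y _; rewrite -!EFinM -!EFinD lee_fin normrM.
    apply: (le_trans (ler_wpM2l (normr_ge0 _) (hpsi y))).
    by rewrite /g le_eqVlt; apply/orP; left; apply/eqP; ring.
rewrite ge0_integralD//; last 2 first.
- by move=> y _; rewrite adde_ge0.
- exact: emeasurable_funD.
rewrite ge0_integralD// !ge0_integralZl_EFin//; try by move=> y _; rewrite lee_fin.
have hx x : (K%:E * \int[mu]_y (g x y)%:E <= (K * box_mass a b)%:E)%E.
  by rewrite EFinM lee_wpmul2l ?lee_fin//; exact: integral_norm_box_indic.
rewrite (_ : K * _ = K * box_mass a b + K * box_mass a b + K * box_mass a b); last by ring.
by rewrite !EFinD !leeD.
Qed.

Lemma integrable_three (a b x1 x2 x3 : 'rV[R]_N) (psi : 'rV[R]_N -> R) (K : R) :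
  0 <= K -> measurable_fun [set: _] psi ->
  (forall y, `|psi y| <= K * (\1_(ocbox (a + x1) (b + x1)) y +
     \1_(ocbox (a + x2) (b + x2)) y + \1_(ocbox (a + x3) (b + x3)) y)) ->
  mu.-integrable [set: _] (fun y => (u y * psi y)%:E).
Proof.
move=> K0 mpsi hpsi; apply/integrableP; split.
  by apply/measurable_EFinP; exact: measurable_funM.
exact: le_lt_trans (integral_norm_three K0 mpsi hpsi) (ltry _).
Qed.

Definition average (c : R) (a b : 'rV[R]_N) : R :=
  \int[mu]_y (u y * bump c a b y).

Lemma integrable_average c a b : 0 < c ->
  mu.-integrable [set: _] (fun y => (u y * bump c a b y)%:E).
Proof.
move=> c0; apply: (@integrable_three a b 0 0 0 _ 1) => //.
  exact: measurable_bump.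
move=> y; rewrite mul1r !addr0 ger0_norm ?bump_ge0//.
have [yab|yab] := pselect (ocbox a b y).
  by rewrite indicE mem_set//= (le_trans (bump_le1 _ _ _ _))//; lra.
by rewrite bump_out// !addr_ge0.
Qed.

Lemma average_le c a b : 0 < c ->
  (`|average c a b|%:E <= \int[mu]_(y in ocbox a b) `|u y|%:E)%E.
Proof.
move=> c0; have i := integrable_average a b c0.
have -> : (`|average c a b|%:E = `|\int[mu]_y (u y * bump c a b y)%:E|)%E.
  by rewrite /average /Rintegral -[X in `|X|%E]fineK//; exact: integrable_fin_num i.
apply: (le_trans (le_abse_integral mu measurableT (measurable_int _ i))).
rewrite [leRHS]integral_mkcond; apply: ge0_le_integral => //.
- by apply: measurableT_comp => //; exact: measurable_int i.
- apply/(measurable_restrictT _ (measurable_ocbox a b)).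
  apply/measurable_EFinP; apply: measurableT_comp => //; exact: measurable_funTS.
- move=> y _; rewrite /patch; case: ifPn => [|/negP yab].
    rewrite inE => yab; rewrite abse_EFin lee_fin normrM ler_piMr//.
    by rewrite ger0_norm ?bump_ge0 ?bump_le1.
  by rewrite bump_out ?mulr0 ?abse0// => h; apply: yab; exact: mem_set.
Qed.

End bump_average.

Section average_regularity.
Context {R : realType} (N : nat).
Local Notation mu := (lebesgue_row N).
Variables (u : 'rV[R]_N -> R) (L : R).
Hypotheses (mu_u : measurable_fun [set: 'rV[R]_N] u) (L0 : 0 <= L).
Hypothesis uL : forall A, measurable A ->
  (\int[mu]_(y in A) `|u y|%:E <= mu A + L%:E)%E.
Variables (c : R) (a b : 'rV[R]_N).
Hypothesis c0 : 0 < c.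

Definition moving_average (x : 'rV[R]_N) : R := average u c (a + x) (b + x).

Let phi := bump c a b.

Lemma moving_averageE x : moving_average x = \int[mu]_y (u y * phi (y - x)).
Proof. by apply: eq_Rintegral => y _; rewrite /phi bump_shift. Qed.

Let integrable_shift x : mu.-integrable [set: _] (fun y => (u y * phi (y - x))%:E).
Proof.
rewrite (_ : (fun y => _) = fun y => (u y * bump c (a + x) (b + x) y)%:E).
  exact: (integrable_average mu_u uL).
by apply/funext => y; rewrite /phi bump_shift.
Qed.

Let phi_out x y : ~ ocbox (a + x) (b + x) y -> phi (y - x) = 0.
Proof. by move=> h; rewrite /phi bump_shift bump_out. Qed.

Let measurable_phi x : measurable_fun [set: 'rV[R]_N] (fun y => phi (y - x)).
Proof.
rewrite (_ : (fun y => _) = bump c (a + x) (b + x)); first exact: measurable_bump.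
by apply/funext => y; rewrite /phi bump_shift.
Qed.

Lemma moving_average_lipschitz : exists2 K, 0 <= K & forall x k,
  `|moving_average (x + k) - moving_average x| <= K * enorm k.
Proof.
have [M tM] := tame_bump a b c0; have M0 := tame_ge0 tM.
exists (M * (3 * box_mass L a b)) => [|x k].
  by rewrite !mulr_ge0// box_mass_ge0.
pose psi y := phi (y - (x + k)) - phi (y - x).
have Mk0 : 0 <= M * enorm k by rewrite mulr_ge0// enorm_ge0.
have mpsi : measurable_fun [set: _] psi by exact: measurable_funB.
(* Two translates suffice here; the second is repeated to fit the bound for three boxes. *)
have hpsi : forall y, `|psi y| <= M * enorm k * (\1_(ocbox (a + (x + k)) (b + (x + k))) y +
    \1_(ocbox (a + x) (b + x)) y + \1_(ocbox (a + x) (b + x)) y).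
  apply: le_three_indic => // [y|y h1 h2 _].
    have [_ + _] := tM; move=> /(_ (y - x) (- k)); rewrite enormN.
    by rewrite -addrA -opprD.
  by rewrite /psi !phi_out// subrr.
have ipsi := integrable_three mu_u uL Mk0 mpsi hpsi.
have le3 := integral_norm_three mu_u uL Mk0 mpsi hpsi.
have -> : moving_average (x + k) - moving_average x = \int[mu]_y (u y * psi y).
  rewrite !moving_averageE -RintegralB//;
    [|exact: integrable_shift|exact: integrable_shift].
  by apply: eq_Rintegral => y _; rewrite -mulrBr.
rewrite -lee_fin (_ : (`| _ |%:E = `|\int[mu]_y (u y * psi y)%:E|)%E); last first.
  by rewrite /Rintegral -[X in `|X|%E]fineK//; exact: integrable_fin_num ipsi.
apply: (le_trans (le_abse_integral mu measurableT (measurable_int _ ipsi))).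
by apply: (le_trans le3); rewrite lee_fin mulrAC.
Qed.

Lemma continuous_moving_average : continuous moving_average.
Proof.
have [K K0 hK] := moving_average_lipschitz => x.
apply/(@cvgrPdist_lt R R 'rV[R]_N (nbhs x) (nbhs_filter x)) => eps eps0.
have cE : enorm (y - x) @[y --> x] --> (0 : R).
  have := @continuous_enorm_sub R N x x; rewrite /continuous_at.
  rewrite [X in _ --> X](_ : _ = 0)// subrr /enorm big1 ?sqrtr0// => i _.
  by rewrite mxE expr0n.
have eK : 0 < eps / (K + 1) by rewrite divr_gt0// ltr_wpDl.
have hx y : `|moving_average x - moving_average y| <= K * enorm (y - x).
  rewrite distrC; have -> : moving_average y = moving_average (x + (y - x)).
    by rewrite addrC subrK.
  exact: hK.
near=> y; apply: (le_lt_trans (hx y)).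
apply: (@le_lt_trans _ _ ((K + 1) * enorm (y - x))).
  by rewrite ler_wpM2r ?enorm_ge0//; lra.
rewrite mulrC -ltr_pdivlMr ?ltr_wpDl//.
by near: y; exact: (cvgr_lt _ cE).
Unshelve. all: by end_near. Qed.

End average_regularity.

(** * Decay of moving averages at infinity *)

Section average_decay.
Context {R : realType} (N : nat).
Local Notation mu := (lebesgue_row N).
Variables (p : R) (u : 'rV[R]_N -> R).
Hypotheses (p1 : 1 <= p) (mu_u : measurable_fun [set: 'rV[R]_N] u).
Hypothesis iu : mu.-integrable [set: 'rV[R]_N] (fun x => (`|u x| `^ p)%:E).

Let centred (n : nat) : set 'rV[R]_N := ocbox (const_mx (- n%:R)) (const_mx n%:R).

Lemma centredP (n : nat) (v : 'rV[R]_N) :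
  ocbox (const_mx (- n%:R)) (const_mx n%:R) v <->
  forall i, - n%:R < v ord0 i <= n%:R.
Proof. by split => h i; have := h i; rewrite /= !mxE in_itv. Qed.

(** Dominated convergence for |u|^p cut off outside growing boxes, every point being eventually
    inside. *)
Lemma powR_tail (eta : R) : 0 < eta -> exists n : nat, forall A, measurable A ->
  (forall y, A y -> ~ ocbox (const_mx (- n%:R)) (const_mx n%:R) y) ->
  (\int[mu]_(y in A) (`|u y| `^ p)%:E <= eta%:E)%E.
Proof.
move=> eta0; pose w (y : 'rV[R]_N) : \bar R := (`|u y| `^ p)%:E.
have w0 y : (0 <= w y)%E by rewrite lee_fin powR_ge0.
have mw : measurable_fun [set: _] w by exact: measurable_int iu.
have mC n : measurable (~` centred n) by apply: measurableC; exact: measurable_ocbox.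
pose f n := w \_ (~` centred n).
have f_cvg y : f n y @[n --> \oo] --> (0%E : \bar R).
  have [k _ hk] : (\bigcup_k centred k) y by rewrite ocbox_cover.
  apply: (cvg_trans (@near_eq_cvg _ _ _ _ (cst 0%E) _ _)); last exact: cvg_cst.
  near=> n; rewrite /f /patch memNset//= => h; apply: h; apply/centredP => i.
  have /centredP /(_ i) /andP[h1 h2] := hk.
  have kn : k%:R <= n%:R :> R by rewrite ler_nat; near: n; exact: nbhs_infty_ge.
  by apply/andP; split; lra.
have [|||||_ _ cv] := @dominated_convergence _ _ R mu [set: _] measurableT f (cst 0%E) w.
- by move=> n; apply/(measurable_restrictT _ (mC n)); exact: measurable_funTS.
- exact: measurable_cst.
- by apply: aeW => y _; exact: f_cvg.
- exact: iu.
- apply: aeW => y n _; rewrite /f /patch; case: ifP => _.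
    by rewrite gee0_abs.
  by rewrite abse0.
rewrite integral_cst// mul0e in cv.
have [n _ /(_ n (leqnn n)) /= hn] : \forall n \near \oo, (\int[mu]_y f n y < eta%:E)%E.
  by apply: (cv [set x | (x < eta%:E)%E]); apply: open_ereal_lt'; rewrite lte_fin.
exists n => A mA An; apply: (le_trans _ (ltW hn)).
rewrite /f -integral_mkcond; apply: ge0_subset_integral => //.
exact: measurable_funTS.
Unshelve. all: by end_near. Qed.

Variables (c : R) (a b : 'rV[R]_N).
Hypothesis c0 : 0 < c.

Lemma moving_average_decay (eps : R) : 0 < eps -> exists r : R, forall x : 'rV[R]_N,
  (exists i, r < `|x ord0 i|) -> `|moving_average u c a b x| < eps.
Proof.
move=> eps0; have [L L0 uL] := integral_norm_uniform p1 mu_u iu.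
pose B := fine (mu (ocbox a b)).
have B0 : 0 <= B by exact: fine_ge0.
have BE : mu (ocbox a b) = B%:E.
  by rewrite fineK// ge0_fin_numE//; exact: lebesgue_row_ocbox_lty.
(* This makes delta times the volume at most eps/3; the 1 avoids division by 0 for an empty box.
   Then n is chosen, after delta, so that the L^p tail contributes at most eps/3. *)
pose delta := eps / 3 / (B + 1).
have d0 : 0 < delta by rewrite !divr_gt0// ltr_wpDl.
have dp0 : 0 < delta `^ (1 - p) by exact: powR_gt0.
have [n hn] := @powR_tail (eps / 3 / delta `^ (1 - p)) (divr_gt0 (divr_gt0 eps0 (ltr0n _ 3)) dp0).
(* If one coordinate of x exceeds this radius, the translated box misses ]-n, n]^N. *)
exists (n%:R + \sum_i (`|a ord0 i| + `|b ord0 i|)) => x [i xi].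
rewrite -lte_fin; apply: (le_lt_trans (average_le mu_u uL _ _ c0)).
have mA := @measurable_ocbox R N (a + x) (b + x).
apply: (le_lt_trans (integral_norm_le_powR p1 mu_u iu mA d0)).
have mB : (mu (ocbox (a + x) (b + x)) <= B%:E)%E.
  by rewrite lebesgue_row_ocbox_shift BE.
apply: (@le_lt_trans _ _ ((delta * B)%:E + (delta `^ (1 - p))%:E * (eps / 3 / delta `^ (1 - p))%:E)%E).
  apply: leeD.
    by rewrite (EFinM delta B) lee_wpmul2l ?lee_fin ?(ltW d0)//; exact: mB.
  rewrite lee_wpmul2l ?lee_fin ?(ltW dp0)//; apply: hn => //.
  move=> y /(_ i) /= yx /centredP /(_ i) /andP[y1 y2]; move: yx.
  rewrite !mxE in_itv/= => /andP[y3 y4].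
  have ab : `|a ord0 i| + `|b ord0 i| <= \sum_i (`|a ord0 i| + `|b ord0 i|).
    by rewrite (bigD1 i)//= lerDl sumr_ge0// => j _; exact: addr_ge0.
  have := ler_norm (a ord0 i); have := ler_norm (b ord0 i).
  have := ler_norm (- a ord0 i); have := ler_norm (- b ord0 i); rewrite !normrN.
  by case: (ger0P (x ord0 i)) xi; lra.
rewrite -EFinM -EFinD lte_fin [_ `^ _ * _]mulrC divfK ?gt_eqF//.
have : delta * B <= eps / 3.
  have -> : eps / 3 = delta * (B + 1) by rewrite /delta divfK// gt_eqF// ltr_wpDl.
  by rewrite ler_wpM2l ?(ltW d0)// lerDl.
by lra.
Qed.

End average_decay.

(** * Passing the equation to moving averages by Fubini *)

Section average_sdq.
Context {R : realType} (N : nat).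
Local Notation mu := (lebesgue_row N).
Variables (s : R) (hs : 0 < s < 1).
Local Notation e := (N%:R + 2 * s).
Variables (u : 'rV[R]_N -> R) (L : R).
Hypotheses (mu_u : measurable_fun [set: 'rV[R]_N] u) (L0 : 0 <= L).
Hypothesis uL : forall A, measurable A ->
  (\int[mu]_(y in A) `|u y|%:E <= mu A + L%:E)%E.
Variables (c : R) (a b : 'rV[R]_N).
Hypothesis c0 : 0 < c.

Lemma ocbox_translate (y h : 'rV[R]_N) :
  ocbox a b (y + h) <-> ocbox (a - h) (b - h) y.
Proof.
by split=> H i; have := H i; rewrite /= !in_itv/= !mxE; lra.
Qed.

Lemma bump_translate (y h : 'rV[R]_N) : bump c a b (y + h) = bump c (a - h) (b - h) y.
Proof. by rewrite -bump_shift opprK. Qed.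

Let phi := bump c a b.
Let f (z : 'rV[R]_N * 'rV[R]_N) : R := u z.1 * sdq s phi z.1 z.2.

Let mphi : measurable_fun [set: _] phi. Proof. exact: measurable_bump. Qed.

Let measurable_shear (k : R) :
  measurable_fun [set: 'rV[R]_N * 'rV[R]_N] (fun z => phi (z.1 + k *: z.2)).
Proof.
have mg : measurable_fun [set: 'rV[R]_N * 'rV[R]_N] (fun z => z.1 + k *: z.2).
  apply: measurable_fun_row => i; under eq_fun do rewrite !mxE.
  apply: measurable_funD.
    exact: (measurableT_comp (measurable_row_coord i) measurable_fst).
  apply: measurable_funM => //.
  exact: (measurableT_comp (measurable_row_coord i) measurable_snd).
exact: (measurableT_comp mphi mg).
Qed.

Let measurable_sdq_l h : measurable_fun [set: 'rV[R]_N] (fun y => sdq s phi y h).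
Proof.
apply: measurable_funM => //; apply: measurable_funB; last first.
  exact: measurable_funM.
apply: measurable_funD; rewrite /phi; under eq_fun do rewrite bump_translate;
  exact: measurable_bump.
Qed.

Let mf : measurable_fun [set: _] f.
Proof.
have m1 := measurable_shear 1; have m2 := measurable_shear (-1).
have m3 : measurable_fun [set: 'rV[R]_N * 'rV[R]_N] (fun z => phi z.1).
  exact: (measurableT_comp mphi measurable_fst).
rewrite (_ : f = fun z => u z.1 * (2^-1 *
    (phi (z.1 + 1 *: z.2) + phi (z.1 + (-1) *: z.2) - 2 * phi z.1) *
    (enorm z.2 `^ e)^-1)); last first.
  apply/funext => z; rewrite /f scale1r scaleN1r /sdq invfM; ring.
apply: measurable_funM; first exact: (measurableT_comp mu_u measurable_fst).
apply: measurable_funM; last exact: (measurableT_comp (measurable_enormV _) measurable_snd).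
by apply: measurable_funM => //; apply: measurable_funB; [exact: measurable_funD|exact: measurable_funM].
Qed.

Let sdq_three M h : tame (@enorm R N) phi M -> forall y,
  `|sdq s phi y h| <= 2 * M * riesz e (enorm h) *
    (\1_(ocbox (a + - h) (b + - h)) y + \1_(ocbox (a + h) (b + h)) y +
     \1_(ocbox (a + 0) (b + 0)) y).
Proof.
move=> tM; have M0 := tame_ge0 tM; apply: le_three_indic.
- by rewrite mulr_ge0 ?riesz_ge0// mulr_ge0.
- by move=> y; exact: sdq_le.
- rewrite !addr0 => y h1 h2 h3; rewrite /sdq /phi.
  rewrite bump_out//; last by move/ocbox_translate.
  rewrite bump_out//; last by move/ocbox_translate; rewrite opprK.
  by rewrite bump_out// mulr0 addr0 subr0 mul0r.
Qed.

(** By Tonelli with y innermost: each section in y is supported in three boxes of uniformly bounded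
    mass, which leaves a multiple of the integrable kernel in h. *)
Let integrable_f : (mu \x mu)%E.-integrable [set: _] (EFin \o f).
Proof.
have [M tM] := tame_bump a b c0; have M0 := tame_ge0 tM.
apply/integrable21ltyP; first exact/measurable_EFinP.
pose K := 2 * M * (3 * box_mass L a b).
have K0 : 0 <= K by rewrite !mulr_ge0// box_mass_ge0.
apply: (@le_lt_trans _ _ (\int[mu]_h (K%:E * (riesz e (enorm h))%:E))%E).
  apply: ge0_le_integral => //.
  - by move=> h _; exact: integral_ge0.
  - have mabs : measurable_fun [set: _] (fun z => `|(f z)%:E|%E).
      by apply: measurableT_comp => //; exact/measurable_EFinP.
    exact: (@measurable_fun_fubini_tonelli_G _ _ _ _ R mu _ mabs (fun z => abse_ge0 _)).
  - apply: emeasurable_funM => //.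
    exact: (measurable_int _ (integrable_riesz_enorm N hs)).
  - move=> h _; have K1 : 0 <= 2 * M * riesz e (enorm h).
      by rewrite mulr_ge0 ?riesz_ge0// mulr_ge0.
    have := integral_norm_three mu_u uL K1 (measurable_sdq_l h) (sdq_three h tM).
    by rewrite -EFinM mulrAC.
by apply: integrable_lty => //; apply: integrableZl => //; exact: integrable_riesz_enorm.
Qed.

(** Integrating phi(y + h) against u gives the average over the box moved by -h, and the second
    difference is even in h. *)
Let inner_integral h :
  \int[mu]_y (u y * sdq s phi y h) = sdq s (fun x => average u c (a + x) (b + x)) 0 h.
Proof.
pose k : R := (2 * enorm h `^ e)^-1.
have ia x := integrable_average mu_u uL (a + x) (b + x) c0.
have i12 : mu.-integrable [set: _] (EFin \o (fun y =>
    u y * bump c (a + h) (b + h) y + u y * bump c (a - h) (b - h) y)).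
  exact: (integrableD measurableT (ia h) (ia (- h))).
have i3 : mu.-integrable [set: _] (EFin \o (fun y => - 2 * (u y * bump c (a + 0) (b + 0) y))).
  exact: (integrableZl measurableT (- 2) (ia 0)).
have i123 : mu.-integrable [set: _] (EFin \o (fun y =>
    u y * bump c (a + h) (b + h) y + u y * bump c (a - h) (b - h) y +
    - 2 * (u y * bump c (a + 0) (b + 0) y))).
  exact: (integrableD measurableT i12 i3).
have h1 := RintegralZl k measurableT i123.
have h2 := RintegralD measurableT i12 i3.
have h3 := RintegralD measurableT (ia h) (ia (- h)).
have h4 := RintegralZl (- 2) measurableT (ia 0).
transitivity (\int[mu]_y (k * (u y * bump c (a + h) (b + h) y +
    u y * bump c (a - h) (b - h) y + - 2 * (u y * bump c (a + 0) (b + 0) y)))).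
  apply: eq_Rintegral => y _; rewrite /sdq /phi !bump_translate opprK !addr0.
  by rewrite -/k; ring.
pose A x := average u c (a + x) (b + x).
have hA := eq_trans h2 (f_equal2 +%R h3 h4).
apply: (eq_trans (eq_trans h1 (f_equal ( *%R k) hA))).
rewrite -[LHS]/(k * (A h + A (- h) + - 2 * A 0)) /sdq add0r sub0r -/k.
have kE (x y z : R) : k * (x + y + - 2 * z) = (x + y - 2 * z) * k by ring.
exact: kE.
Qed.

Hypothesis hsu : fraclap_distr_eq0 s u.

(** Evaluating at 0 loses nothing, because the box is arbitrary; [average_eq0] reaches the other
    points by moving it. *)
Lemma average_sdq :
  let v := sdq s (fun x => average u c (a + x) (b + x)) 0 in
  measurable_fun [set: _] v /\ (\int[mu]_h (v h)%:E = 0)%E.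
Proof.
move=> v; have [M tM] := tame_bump a b c0.
have M0 := tame_ge0 tM; have C0 := fraclap_const_gt0 N hs.
have K1 (h : 'rV[R]_N) : 0 <= 2 * M * riesz e (enorm h).
  by rewrite mulr_ge0 ?riesz_ge0// mulr_ge0.
have Fub : (\int[mu]_y fubini_F mu (EFin \o f) y =
            \int[mu]_h fubini_G mu (EFin \o f) h)%E := Fubini integrable_f.
have mG := measurable_fubini_G integrable_f.
have iF := integrable_fubini_F integrable_f.
have vE : fubini_G mu (EFin \o f) = EFin \o v.
  apply/funext => h.
  have ih := integrable_fin_num measurableT
    (integrable_three mu_u uL (K1 h) (measurable_sdq_l h) (sdq_three h tM)).
  apply: (eq_trans (esym (fineK ih))).
  exact: (f_equal EFin (inner_integral h)).
pose w y := u y * \int[mu]_h sdq s phi y h.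
have wE : fubini_F mu (EFin \o f) = EFin \o w.
  apply/funext => y; have iy := integrable_sdq hs mphi tM y.
  apply: (eq_trans (integralZl measurableT iy (u y))).
  rewrite /= /w EFinM; congr (_ * _)%E.
  exact: esym (fineK (integrable_fin_num measurableT iy)).
rewrite vE in mG Fub; rewrite wE in iF Fub.
split; first exact/measurable_EFinP.
have h0 : (\int[mu]_y (u y * fraclap s phi y)%:E = 0)%E.
  by apply: hsu; exact: test_function_bump.
have h1 : (\int[mu]_y (u y * fraclap s phi y)%:E =
    (- fraclap_const N s)%:E * \int[mu]_y (w y)%:E)%E.
  apply: (eq_trans _ (integralZl measurableT iF _)).
  apply: eq_integral => y _; rewrite (fraclapE hs mphi tM) /w /= -EFinM.
  have kE (k l m : R) : k * - (l * m) = - l * (k * m) by ring.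
  by congr EFin; exact: kE.
(* The normalising constant is positive and can be divided out. *)
have : (\int[mu]_y (w y)%:E = 0)%E.
  move: (eq_trans (esym h0) h1) => /esym/eqP.
  by rewrite mule_eq0 eqe oppr_eq0 (gt_eqF C0)/= => /eqP.
exact: eq_trans (esym Fub).
Qed.

End average_sdq.

(** * Maximum principle *)

Lemma sdq_max_principle {R : realType} (N : nat) (s : R) (v : 'rV[R]_N -> R) :
  (1 <= N)%N -> continuous v ->
  (forall eps, 0 < eps -> exists r : R, forall x : 'rV[R]_N,
     (exists i, r < `|x ord0 i|) -> `|v x| < eps) ->
  (forall x, measurable_fun [set: _] (sdq s v x) /\
     (\int[lebesgue_row N]_h (sdq s v x h)%:E = 0)%E) ->
  forall x, v x <= 0.
Proof.
move=> N0 cv decay hv x1; rewrite leNgt; apply/negP => v1.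
(* Decay at level v x1 confines all larger values to a cube, so the maximum over the cube is
   global. *)
have [r hr] := decay _ v1; pose i0 := Ordinal N0.
pose K := [set x : 'rV[R]_N | forall i, `[- r, r]%classic (x ord0 i)].
have K_out x : ~ K x -> v x < v x1.
  move=> /existsNP[i xi]; apply: le_lt_trans (ler_norm _) (hr _ _); exists i.
  by rewrite ltNge; apply/negP => h; apply: xi; rewrite /= in_itv/= -ler_norml.
have Kx1 : K x1 by apply: contrapT => /K_out; rewrite ltxx.
have cK : compact K.
  by apply: (@rV_compact R N (fun=> `[- r, r]%classic)) => i; exact: segment_compact.
have K0 : K !=set0 by exists x1.
have [c _ hc] := EVT_max_rV K0 cK (continuous_subspaceT cv).
have vc x : v x <= v c.
  have [Kx|/K_out/ltW vx] := pselect (K x); first by apply: hc; rewrite inE.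
  by apply: (le_trans vx); apply: hc; rewrite inE.
have vc_out x : ~ K x -> v x < v c by move=> /K_out vx; exact: lt_le_trans vx (vc x1).
have sdq_le0 h : sdq s v c h <= 0.
  rewrite /sdq mulr_le0_ge0 ?invr_ge0 ?mulr_ge0 ?powR_ge0//.
  by have := vc (c + h); have := vc (c - h); lra.
(* A step h with h_i0 > B takes both c + h and c - h out of the cube, where v is strictly below its
   maximum. The box [D] of such steps has measure 1. *)
pose B := `|r| + `|c ord0 i0|.
pose D := ocbox (const_mx B) (const_mx (B + 1)) : set 'rV[R]_N.
have sdq_lt0 h : D h -> sdq s v c h != 0.
  move=> /(_ i0); rewrite /= !mxE in_itv/= => /andP[Bh _].
  have rr := ler_norm r; have nc := ler_norm (c ord0 i0).
  have nc' := ler_norm (- c ord0 i0); rewrite normrN in nc'.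
  have r0 := normr_ge0 r; have c0 := normr_ge0 (c ord0 i0).
  have e0 : 0 < enorm h.
    by apply: (@enorm_gt0 _ _ _ i0); rewrite gt_eqF// (le_lt_trans _ Bh)// addr_ge0.
  have h1 : v (c + h) < v c.
    apply: vc_out => /(_ i0); rewrite /= !mxE in_itv/=; move: Bh; rewrite /B; lra.
  have h2 : v (c - h) < v c.
    apply: vc_out => /(_ i0); rewrite /= !mxE in_itv/=; move: Bh; rewrite /B; lra.
  rewrite lt_eqF// /sdq pmulr_llt0; first lra.
  by rewrite invr_gt0 mulr_gt0// powR_gt0.
have [msdq isdq] := hv c.
(* A quotient of constant sign with zero integral vanishes almost everywhere, against its strict
   negativity on [D]. *)
have iabs : (\int[lebesgue_row N]_h `|(sdq s v c h)%:E| = 0)%E.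
  have H := @integral_ge0N _ _ R (lebesgue_row N) [set: _]
    (fun h => `|(sdq s v c h)%:E|%E) (fun h _ => abse_ge0 _).
  apply/eqP; rewrite -oppe_eq0; apply/eqP; apply: (eq_trans (esym H)).
  apply: (eq_trans _ isdq); apply: eq_integral => h _.
  by rewrite lee0_abs ?lee_fin// oppeK.
have msdqE : measurable_fun [set: 'rV[R]_N] (EFin \o sdq s v c).
  exact/measurable_EFinP.
have [A [mA A0 DA]] := (ae_eq_integral_abs (lebesgue_row N) measurableT msdqE).1 iabs.
have mD : measurable D by exact: measurable_ocbox.
have D0 : lebesgue_row N D = 0%E.
  apply: (subset_measure0 mD mA _ A0) => h Dh; apply: DA => /(_ I) /= [] /eqP.
  by rewrite (negPf (sdq_lt0 h Dh)).
have D1 := lebesgue_row_ocbox (const_mx B) (const_mx (B + 1) : 'rV[R]_N).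
have := eq_trans (esym D0) D1; rewrite (eq_bigr (fun=> 1%E)); last first.
  move=> i _; rewrite lebesgue_measure_itv/= !mxE lte_fin ltrDl ltr01 -EFinB.
  by congr EFin; ring.
by rewrite big1_eq => /eqP; rewrite eqe eq_sym oner_eq0.
Qed.

(** * Conclusion *)

(** Since u is integrable only on bounded boxes, the passage from boxes to Borel sets by a Dynkin
    argument takes place inside each cube [C n]. *)
Lemma ae_eq0_ocbox {R : realType} (N : nat) (u : 'rV[R]_N -> R) :
  measurable_fun [set: _] u ->
  (forall a b, (lebesgue_row N).-integrable (ocbox a b) (EFin \o u)) ->
  (forall a b, \int[lebesgue_row N]_(y in ocbox a b) (u y)%:E = 0)%E ->
  {ae lebesgue_row N, forall x, u x = 0}.
Proof.
move=> mu_u iu u0; set mu := lebesgue_row N.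
pose C (n : nat) : set 'rV[R]_N := ocbox (const_mx (- n%:R)) (const_mx n%:R).
have mC n : measurable (C n) by exact: measurable_ocbox.
have CE n A : measurable A -> (\int[mu]_(y in A `&` C n) (u y)%:E = 0)%E.
  rewrite {1}measurable_ocboxes; move=> mA.
  have iS A' : measurable A' -> mu.-integrable (A' `&` C n) (EFin \o u).
    move=> mA'.
    exact: (integrableS (mC n) (measurableI _ _ mA' (mC n)) (@subIsetr _ _ _) (iu _ _)).
  apply: (dynkin_induction (P := fun A => (\int[mu]_(y in A `&` C n) (u y)%:E = 0)%E)
    (measurable_ocboxes N) (@ocboxes_setI R N) _ _ _ _ mA).
  - by rewrite setTI; exact: u0.
  - move=> _ [a _ [b _ <-]].
    have [c _ [d _ <-]] : ocboxes (ocbox a b `&` C n).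
      by apply: ocboxes_setI; [exists a => //; exists b|eexists => //; eexists].
    exact: u0.
  - move=> S mS S0; have := u0 (const_mx (- n%:R)) (const_mx n%:R).
    have CS : ocbox (const_mx (- n%:R)) (const_mx n%:R) = (S `&` C n) `|` (~` S `&` C n).
      by rewrite -setIUl setUv setTI.
    rewrite {1}CS integral_setU//.
    - by rewrite S0 add0e.
    - exact: measurableI.
    - by apply: measurableI => //; exact: measurableC.
    - exact/measurable_EFinP/measurable_funTS.
    - by apply/disj_setPS => x [[Sx _] [nSx _]].
  - move=> F mF tF F0; rewrite setI_bigcupl integral_bigcup//.
    + by apply: eseries0 => k _ _; exact: F0.
    + exact: trivIset_setIr.
    + by move=> k; exact: measurableI.
    + by rewrite -setI_bigcupl; apply: iS; exact: bigcupT_measurable.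
have aeC n : {ae mu, forall x, C n x -> (u x)%:E = (cst 0%E x : \bar R)}.
  apply: (integral_ae_eq (mC n) (iu _ _)) => // E EC mE.
  by rewrite integral0 -(CE n E mE) (setIidl EC).
have := ae_foralln aeC; apply: filterS => x hx.
have [k _ Ckx] : (\bigcup_k C k) x by rewrite /C ocbox_cover.
by have [] := hx k Ckx.
Qed.

Lemma sdqN {R : realType} (N : nat) (s : R) (v : 'rV[R]_N -> R) x h :
  sdq s (\- v) x h = - sdq s v x h.
Proof.
have E (k l m n : R) : (- k + - l - 2 * - m) * n = - ((k + l - 2 * m) * n) by ring.
exact: E.
Qed.

(* As oo - oo = -oo, the hypothesis forces both parts of f to be integrable. *)
Lemma integral_eq0N d (T : measurableType d) (R : realType)
    (mu : {measure set T -> \bar R}) (D : set T) (f : T -> \bar R) :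
  (\int[mu]_(x in D) f x = 0 -> \int[mu]_(x in D) (- f x) = 0)%E.
Proof.
rewrite integralE [in X in _ -> X]integralE => H.
rewrite [X in (X - _)%E](_ : _ = \int[mu]_(x in D) f^\- x)%E; last first.
  by apply: eq_integral => x _; rewrite funeposN.
rewrite [X in (_ - X)%E](_ : _ = \int[mu]_(x in D) f^\+ x)%E; last first.
  by apply: eq_integral => x _; rewrite funenegN.
move: H; move: (\int[mu]_(x in D) f^\+ x)%E (\int[mu]_(x in D) f^\- x)%E.
move=> [k||] [l||]//=; rewrite -!EFinB => -[kl]; congr EFin; lra.
Qed.

Lemma average_eq0 {R : realType} (N : nat) (hN : (1 <= N)%N) (s : R) (hs : 0 < s < 1)
    (p : R) (p1 : 1 <= p) (u : 'rV[R]_N -> R) :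
  measurable_fun [set: _] u ->
  (lebesgue_row N).-integrable [set: 'rV[R]_N] (fun x => (`|u x| `^ p)%:E) ->
  fraclap_distr_eq0 s u ->
  forall c a b, 0 < c -> average u c a b = 0.
Proof.
move=> mu_u iu hsu c a b c0; have [L L0 uL] := integral_norm_uniform p1 mu_u iu.
pose v := moving_average u c a b.
have cv : continuous v by exact: (continuous_moving_average mu_u L0 uL).
have decay eps : 0 < eps -> exists r : R, forall x : 'rV[R]_N,
    (exists i, r < `|x ord0 i|) -> `|v x| < eps.
  exact: (moving_average_decay p1 mu_u iu).
have hv x : measurable_fun [set: _] (sdq s v x) /\
    (\int[lebesgue_row N]_h (sdq s v x h)%:E = 0)%E.
  (* Moving the box by x turns the statement at 0 into the statement at x. *)
  have A y : average u c (a + x + y) (b + x + y) = v (x + y).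
    by rewrite /v /moving_average !addrA.
  have E : sdq s (fun y => average u c (a + x + y) (b + x + y)) 0 = sdq s v x.
    by apply/funext => h; rewrite /sdq !A addr0 add0r sub0r.
  rewrite -E; exact: (@average_sdq _ _ _ hs _ _ mu_u L0 uL _ (a + x) (b + x) c0 hsu).
have v0 : v 0 <= 0 by exact: (sdq_max_principle hN cv decay hv).
have Nv0 : - v 0 <= 0.
  apply: (@sdq_max_principle _ _ s (\- v) hN) => [x|eps eps0|x].
  - by apply: continuousN; exact: cv.
  - have [r hr] := decay _ eps0; exists r => x /hr.
    by rewrite normrN.
  - have [mx ix] := hv x; rewrite (_ : sdq s (\- v) x = \- sdq s v x); last first.
      by apply/funext => h; rewrite sdqN.
    split; first exact: measurable_funN.
    exact: (integral_eq0N ix).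
have : v 0 = 0 by lra.
by rewrite /v /moving_average !addr0.
Qed.

Theorem corollary1p3 (R : realType) (N : nat) (hN : (1 <= N)%N)
  (s : R) (hs : 0 < s < 1) (p : R) (hp : 1 <= p)
  (u : 'rV[R]_N -> R) (hu : u \in Lfun (@lebesgue_row R N) p%:E)
  (hsu : fraclap_distr_eq0 s u) :
  {ae @lebesgue_row R N, forall x, u x = 0}.
Proof.
have mu_u : measurable_fun [set: _] u by have /set_mem := sub_Lfun_mfun hu.
have iu := Lfun_integrable hp hu.
have [L L0 uL] := integral_norm_uniform hp mu_u iu.
apply: ae_eq0_ocbox => // [a b|a b]; first exact: integrable_box mu_u uL a b.
(* All approximating bumps live in this larger box because 1/(n+1) <= 1; |u| is integrable there and
   dominates. *)
pose b1 : 'rV[R]_N := b + const_mx 1.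
have i1 : (lebesgue_row N).-integrable [set: _] (fun y => (`|u y| * \1_(ocbox a b1) y)%:E).
  have := (integrable_mkcond _ (measurable_ocbox a b1)).1 (integrable_abse (integrable_box mu_u uL a b1)).
  rewrite (_ : _ \_ _ = fun y => (`|u y| * \1_(ocbox a b1) y)%:E)//.
  by apply/funext => y; rewrite /patch indicE; case: (y \in _); rewrite ?mulr1 ?mulr0.
have [||||| _ _ cv] := @dominated_convergence _ _ R (lebesgue_row N) [set: _] measurableT
  (fun n y => (u y * bump_approx a b n y)%:E)
  (fun y => (u y * \1_(ocbox a b) y)%:E)
  (fun y => (`|u y| * \1_(ocbox a b1) y)%:E).
- move=> n; apply/measurable_EFinP; apply: measurable_funM => //; exact: measurable_bump.
- apply/measurable_EFinP; apply: measurable_funM => //.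
  by apply: measurable_indic; exact: measurable_ocbox.
- apply: aeW => y _; apply: cvg_EFin; first exact: nearW.
  by apply: cvgMl_tmp; exact: bump_approx_cvg.
- exact: i1.
- apply: aeW => y n _; rewrite abse_EFin lee_fin normrM ler_wpM2l//.
  by rewrite ger0_norm ?bump_ge0// bump_approx_le.
rewrite [LHS](_ : _ = \int[lebesgue_row N]_y (u y * \1_(ocbox a b) y)%:E)%E; last first.
  rewrite integral_mkcond; apply: eq_integral => y _.
  by rewrite /patch indicE; case: (y \in _); rewrite ?mulr1 ?mulr0.
apply/esym; move: cv => /cvg_lim <-//; apply/esym.
(* Every term is the average of u against a bump, hence 0. *)
rewrite (_ : [sequence _]_n = cst 0%E); first exact: lim_cst.
apply/funext => n /=.
have n0 : 0 < n.+1%:R ^+ 2 :> R by rewrite exprn_gt0.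
have := average_eq0 hN hs hp mu_u iu hsu a (b + const_mx n.+1%:R^-1) n0.
rewrite /average /Rintegral => h.
rewrite -[LHS]fineK; first by rewrite h.
exact: (integrable_fin_num measurableT (integrable_average mu_u uL a (b + const_mx n.+1%:R^-1) n0)).
Qed.
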